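(* Let $A$ be a four-dimensional power-commutative real division algebra. Then $A$ contains an omnipresent idempotent, i.e. there is a non-zero element $e\in A$ with $e^2=e$ that is contained in every two-dimensional subalgebra of $A$.
   Context: An algebra is a finite-dimensional real vector space $A$ with a bilinear multiplication (not necessarily associative, commutative or unital). A subalgebra is a linear subspace closed under multiplication. A division algebra is an algebra in which the linear maps $x\mapsto ax$ and $x\mapsto xa$ are bijective for every non-zero $a\in A$. An algebra is power-commutative if every subalgebra generated by a single element is commutative. An omnipresent idempotent of $A$ is a non-zero idempotent contained in every two-dimensional subalgebra of $A$. *)

(* Defs.v *)
From mathcomp Require Import all_boot all_order all_algebra.
From mathcomp Require Import reals.

Set Implicit Arguments.
Unset Strict Implicit.
Unset Printing Implicit Defensive.

Import GRing.Theory.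
Local Open Scope ring_scope.

(* A finite-dimensional algebra is a [vectType] with a bilinear product [mul].
   The library's [falgType] is not used, since it is associative and unital. *)

Definition division_algebra (K : fieldType) (A : vectType K)
    (mul : {bilinear A -> A -> A}) : Prop :=
  forall a : A, a != 0 -> bijective (fun x => mul a x) /\ bijective (fun x => mul x a).

Definition is_subalgebra (K : fieldType) (A : vectType K)
    (mul : {bilinear A -> A -> A}) (U : {vspace A}) : Prop :=
  forall x y : A, x \in U -> y \in U -> mul x y \in U.

(* The subalgebra generated by [a], given by its elements as the intersection
   of all subalgebras containing [a]. *)
Definition in_generated (K : fieldType) (A : vectType K)
    (mul : {bilinear A -> A -> A}) (a x : A) : Prop :=
  forall U : {vspace A}, is_subalgebra mul U -> a \in U -> x \in U.

Definition power_commutative (K : fieldType) (A : vectType K)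
    (mul : {bilinear A -> A -> A}) : Prop :=
  forall a x y : A,
    in_generated mul a x -> in_generated mul a y -> mul x y = mul y x.

Definition omnipresent_idempotent (K : fieldType) (A : vectType K)
    (mul : {bilinear A -> A -> A}) (e : A) : Prop :=
  [/\ e != 0,
      mul e e = e
    & forall U : {vspace A}, is_subalgebra mul U -> \dim U = 2%N -> e \in U].

(* Main.v *)
(* By power-commutativity the subalgebra generated by an element [x] is a
   commutative division algebra, so by Hopf's theorem it has dimension at most
   two and lies in the plane of [x] and [x^2] (unless [x^2] is a multiple of
   [x]). Hopf's theorem is proved by lifting: in dimension at least three, the
   loop of squares of a suitable path from [u] to [-u] could be contracted in
   the complement of [0], where square roots exist locally and are unique up to
   sign, so the square root followed along the loop would return to itself,
   whereas it changes sign.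

   If idempotents [e] and [f] do not span a subalgebra, then, for
   [h = e + f - (ef + fe)] and [x] in the span of [e] and [f], the plane of [x]
   and [x^2] contains [h]; hence there is a pencil: an idempotent [h] and a
   hyperplane [W] such that all planes of [W] through [h] are subalgebras. Three
   independent idempotents spanning subalgebras pairwise also give a pencil.
   Otherwise there are at most three idempotents, and one of them is
   omnipresent because the condition on [x] that [x^2] be in the span of [e] and
   [x] is polynomial.

   Given a pencil, [x^2 = psi(x) x - eps(x)] with [psi] linear and [eps]
   quadratic with values in [W], and [eps(x)] is a multiple of an idempotent.
   If [h] is not omnipresent, [eps] takes values in a quadric cone of [W].
   Let [l] be the eigenvalue of [x |-> hx + xh] on [W / h]. For [l <> 1] this is
   impossible; for [l = 1] it forces a second pencil, whose eigenvalue is not 1. *)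
From HB Require Import structures.
Require Import Defs.
From mathcomp Require Import all_boot all_order all_algebra reals.
From mathcomp Require Import classical_sets boolp topology normedtype derive.
From mathcomp Require Import ring lra.

Set Implicit Arguments.
Unset Strict Implicit.
Unset Printing Implicit Defensive.

Import Order.TTheory GRing.Theory Num.Theory.
Import numFieldNormedType.Exports.
Local Open Scope ring_scope.

(** * Hopf's theorem *)

Lemma continuous_sum (R : realType) (W : normedModType R) (T : topologicalType)
    (I : Type) (r : seq I) (f : I -> T -> W) :
  (forall i, continuous (f i)) -> continuous (fun t => \sum_(i <- r) f i t).
Proof.
move=> cf; elim: r => [|i r IH].
  rewrite (_ : (fun _ => _) = fun=> 0); first exact: cst_continuous.
  by apply/funext => t; rewrite big_nil.
rewrite (_ : (fun _ => _) = fun t => f i t + \sum_(j <- r) f j t).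
  by move=> t; apply: cvgD; [exact: cf|exact: IH].
by apply/funext => t; rewrite big_cons.
Qed.

(** * Continuity and norm bounds of bilinear products on row vectors *)

Section BilinearRow.
Local Open Scope classical_set_scope.
Local Open Scope ring_scope.
Variables (R : realType) (n : nat).
Local Notation V := 'rV[R]_n.
Variable B : {bilinear V -> V -> V}.

Lemma bilinear_row_sum (x y : V) :
  B x y = \sum_i \sum_j (x ord0 i * y ord0 j) *: B (delta_mx 0 i) (delta_mx 0 j).
Proof.
rewrite {1}(row_sum_delta x) linear_sumlz; apply: eq_bigr => i _.
rewrite linearZl_LR /= {1}(row_sum_delta y) linear_sumr scaler_sumr.
by apply: eq_bigr => j _; rewrite linearZr_LR /= scalerA.
Qed.

Lemma bilinear_row_continuous (T : topologicalType) (f g : T -> V) :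
  continuous f -> continuous g -> continuous (fun t => B (f t) (g t)).
Proof.
move=> cf cg.
rewrite (_ : (fun _ => _) = fun t => \sum_i \sum_j
  (f t ord0 i * g t ord0 j) *: B (delta_mx 0 i) (delta_mx 0 j)); last first.
  by apply/funext => s; rewrite bilinear_row_sum.
apply: continuous_sum => i; apply: continuous_sum => j t.
apply: cvgZr_tmp; apply: cvgM.
  by apply: (@continuous_comp _ _ _ f (fun M : V => M ord0 i));
     [exact: cf|exact: coord_continuous].
by apply: (@continuous_comp _ _ _ g (fun M : V => M ord0 j));
   [exact: cg|exact: coord_continuous].
Qed.

Lemma row_sphere_compact : compact [set x : V | `|x| = 1].
Proof.
apply: bounded_closed_compact.
  by exists 1; split=> [|x x1 y /= ->]; [exact: num_real|exact: ltW].
rewrite (_ : [set x : V | _] = (fun x : V => `|x|) @^-1` [set 1])%classic //.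
apply: preimage_closed; first by move=> x _; exact: norm_continuous.
exact: closed_eq.
Qed.

Lemma row_ball_compact (r : R) : compact [set x : V | `|x| <= r].
Proof.
apply: bounded_closed_compact.
  exists r; split=> [|x x1 y /= yr]; [exact: num_real|exact: le_trans yr (ltW _)].
rewrite (_ : [set x : V | _] = (fun x : V => `|x|) @^-1` [set t | t <= r])%classic //.
apply: preimage_closed; first by move=> x _; exact: norm_continuous.
exact: closed_le.
Qed.

(** [|B x y|] attains its extrema on the compact product of two unit spheres; the minimum is
    positive for lack of zero divisors, and both bounds scale to all [x] and [y]. *)
Lemma bilinear_row_bounds : (forall x y, B x y = 0 -> x = 0 \/ y = 0) ->
  exists k C : R, [/\ 0 < k, 0 < C &
    forall x y, k * (`|x| * `|y|) <= `|B x y| /\ `|B x y| <= C * (`|x| * `|y|)].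
Proof.
move=> nzd; have [V0|/existsNP [c /eqP c0]] := pselect (forall x : V, x = 0).
  exists 1, 1; split=> // x y; by rewrite (V0 x) linear0l !normr0 !mul0r !mulr0.
pose S := ([set x : V | `|x| = 1])%classic.
pose f (p : V * V) := `|B p.1 p.2|.
have cS : compact (S `*` S)%classic.
  by apply: compact_setX; exact: row_sphere_compact.
have cf : {within (S `*` S)%classic, continuous f}.
  apply: continuous_subspaceT => p; rewrite /f.
  apply: (@continuous_comp _ _ _ (fun p : V * V => B p.1 p.2)).
    apply: bilinear_row_continuous => q; [exact: cvg_fst|exact: cvg_snd].
  exact: norm_continuous.
have c0' : `|c| != 0 by rewrite normr_eq0.
have Sc : S (`|c|^-1 *: c) by rewrite /S /= normrZ normfV normr_id mulVf.
have SS0 : (S `*` S !=set0)%classic by exists (`|c|^-1 *: c, `|c|^-1 *: c).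
have [[a1 a2]] := compact_EVT_min SS0 cS cf.
rewrite inE => -[/= Sa1 Sa2] amin.
have [[b1 b2] _ bmax] := compact_EVT_max SS0 cS cf.
have Bn x y : x != 0 -> y != 0 ->
    `|B x y| = (`|x| * `|y|) * f (`|x|^-1 *: x, `|y|^-1 *: y).
  move=> x0 y0; rewrite /f /= (linearZl_LR B) (linearZr_LR B) /= !normrZ !normfV !normr_id.
  by field; rewrite !normr_eq0 x0 y0.
have SSn x y : x != 0 -> y != 0 ->
    (`|x|^-1 *: x, `|y|^-1 *: y) \in (S `*` S)%classic.
  by move=> x0 y0; rewrite inE; split; rewrite /S /= normrZ normfV normr_id mulVf //
     normr_eq0.
exists (f (a1, a2)), (f (b1, b2) + 1); split.
- rewrite normr_gt0; apply/eqP => /nzd /= [] z0;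
    [move: Sa1|move: Sa2]; rewrite /S /= z0 normr0 => /eqP; rewrite eq_sym oner_eq0 //.
- by apply: ltr_wpDl => //; exact: normr_ge0.
move=> x y; have [->|x0] := eqVneq x 0.
  by rewrite (linear0l B) normr0 mul0r !mulr0 lexx.
have [->|y0] := eqVneq y 0.
  by rewrite (linear0r B) normr0 !mulr0 lexx.
rewrite Bn //; have := amin _ (SSn _ _ x0 y0); have := bmax _ (SSn _ _ x0 y0).
set F := f (_ *: _, _); move=> h1 h2; split.
  by rewrite mulrC; apply: ler_wpM2l => //; rewrite mulr_ge0.
by rewrite [leRHS]mulrC; apply: ler_wpM2l; [rewrite mulr_ge0|lra].
Qed.
End BilinearRow.

(** * Square roots: uniqueness up to sign, local existence, lifting along a grid *)

Section SquareRoots.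
Local Open Scope classical_set_scope.
Local Open Scope ring_scope.
Variables (R : realType) (n : nat).
Local Notation V := 'rV[R]_n.
Variable B : {bilinear V -> V -> V}.
Hypothesis Bcomm : forall x y, B x y = B y x.
Hypothesis nzd : forall x y, B x y = 0 -> x = 0 \/ y = 0.

Lemma bilinear_row_onto (x z : V) : x != 0 -> exists y, B x y = z.
Proof.
move=> x0; have : lin1_mx (B x) \in unitmx.
  rewrite -row_free_unit -kermx_eq0; apply/eqP/row_matrixP => i.
  rewrite row0; have : row i (kermx (lin1_mx (B x))) *m lin1_mx (B x) = 0.
    by apply/sub_kermxP/row_sub.
  by rewrite mul_rV_lin1 /= => /nzd [xe|//]; rewrite xe eqxx in x0.
move=> u; exists (z *m invmx (lin1_mx (B x))).
by rewrite -[LHS](mul_rV_lin1 (B x)) mulmxKV.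
Qed.

Lemma sq_sub (x y : V) : B x x - B y y = B (x - y) (x + y).
Proof.
rewrite linearDr linearBl linearBl (Bcomm y x) [LHS]addrC.
by rewrite addrA subrK addrC.
Qed.

Lemma sq_eq (x y : V) : B x x = B y y -> x = y \/ x = - y.
Proof.
move=> /eqP; rewrite -subr_eq0 sq_sub => /eqP/nzd[] /eqP.
  by rewrite subr_eq0 => /eqP; left.
by rewrite addr_eq0 => /eqP; right.
Qed.

(* A minimiser [y] of [|B y y - p|] is not [0], because [x] does better; then
   [B y] is onto, and the minimum can only be [0]. *)
Lemma sqroot_step (x p : V) : `|p - B x x| < `|p| -> exists y, B y y = p.
Proof.
move=> xp; have [k [C [k0 C0 kC]]] := bilinear_row_bounds nzd.
(* Outside the ball of radius [r] the bound [k |y|^2] makes [f y] exceed [|p|], so a minimum over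
   the ball is a global one. *)
pose r := 1 + 2 * `|p| / k.
have p0 := normr_ge0 p.
have kr : k * r = k + 2 * `|p| by rewrite /r; field; lra.
have r1 : 1 <= r by rewrite lerDl divr_ge0 ?mulr_ge0 // ltW.
pose f y := `|B y y - p|.
have big y : ~~ (`|y| <= r) -> `|p| < f y.
  rewrite -ltNge => yr; have [h _] := kC y y.
  have : `|B y y| <= f y + `|p| by rewrite -{1}(subrK p (B y y)) ler_normD.
  have : k * r < k * (`|y| * `|y|).
    by rewrite ltr_pM2l //; nra.
  by move=> *; lra.
have fx : f x < `|p| by rewrite /f distrC.
have xr : `|x| <= r by apply/negPn/negP => /big; rewrite ltNge (ltW fx).
have cf : {within [set y : V | `|y| <= r], continuous f}.
  apply: continuous_subspaceT => y.
  apply: (@continuous_comp _ _ _ (fun y : V => B y y - p) Num.norm).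
    apply: continuousB; last exact: cst_continuous.
    by apply: bilinear_row_continuous => q; exact: cvg_id.
  exact: norm_continuous.
have [|y yr ymin] := compact_EVT_min _ (@row_ball_compact R n r) cf.
  by exists x.
have fy : f y < `|p| by apply: le_lt_trans fx; apply: ymin; rewrite inE.
have ming z : f y <= f z.
  have [zr|/big zr] := boolP (`|z| <= r); first by apply: ymin; rewrite inE.
  exact: ltW (lt_trans fy zr).
have y0 : y != 0.
  by apply/eqP => y0; move: fy; rewrite /f y0 (linear0l B) sub0r normrN ltxx.
(* Along [y + t h] the error shrinks by the factor [1 - t] up to a term [t^2 w]; the [t] below
   satisfies [t w < f y], against minimality. *)
have [h hh] := bilinear_row_onto (2^-1 *: (p - B y y)) y0.
exists y; apply/eqP; rewrite -subr_eq0 -normr_eq0 -/(f y); apply/negPn/negP => e0.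
have e1 : 0 < f y by rewrite lt_def e0 normr_ge0.
set w := `|B h h|; have w0 : 0 <= w := normr_ge0 _.
pose d := f y + w + 1; have d0 : 0 < d by rewrite /d; lra.
pose t := f y / d.
have td : t * d = f y by rewrite /t; field; lra.
have t0 : 0 < t by rewrite /t divr_gt0.
have t1 : t < 1 by rewrite /t ltr_pdivrMr // mul1r /d; lra.
clearbody t.
have : f (y + t *: h) <= (1 - t) * f y + t ^+ 2 * w.
  have -> : f (y + t *: h) = `|(1 - t) *: (B y y - p) + t ^+ 2 *: B h h|.
    rewrite /f; congr `|_|; apply/rowP => i.
    have := congr1 (fun v : V => v 0 i) hh; rewrite !mxE => hi.
    rewrite linearDr !linearDl !(linearZl_LR B) !(linearZr_LR B) /= (Bcomm h y).
    by rewrite !mxE hi; field.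
  apply: le_trans (ler_normD _ _) _; rewrite (normrZ (1 - t)) (normrZ (t ^+ 2)) -/(f y) -/w.
  have t1' : 0 <= 1 - t by lra.
  by rewrite (ger0_norm t1') (ger0_norm (sqr_ge0 t)) lexx.
have := ming (y + t *: h) => h1 h2.
have : t * f y <= t * (t * w) by move: (le_trans h1 h2); lra.
by rewrite ler_pM2l // -td /d => ?; nra.
Qed.

(* Square roots along a grid of points [Q i j] are followed from [Q i 0];
   since opposite roots are far apart, neighbouring columns stay close. *)
Lemma grid_lift (Q : nat -> nat -> V) (y : nat -> V) (c : V) (e : R) (N : nat) :
  0 <= e ->
  (forall i, Q i 0%N = B c c) ->
  (forall i, Q i N = B (y i) (y i)) ->
  (forall j, Q 0%N j = Q N j) ->
  y N = - y 0%N ->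
  (forall i, (i < N)%N -> `|y i - y i.+1| <= e) ->
  (forall i j x, (i <= N)%N -> (j <= N)%N -> B x x = Q i j -> 2 * e < `|x|) ->
  (forall i j x, (i <= N)%N -> (j < N)%N -> B x x = Q i j ->
    exists2 x', B x' x' = Q i j.+1 & `|x - x'| <= e) ->
  (forall i j x x', (i < N)%N -> (j <= N)%N -> B x x = Q i j ->
    B x' x' = Q i.+1 j -> `|x - x'| <= e \/ `|x + x'| <= e) ->
  False.
Proof.
move=> e0 Q0 QN Qper yN ystep xbig xnext xside.
have tri (a b d : V) : `|a - d| <= `|a - b| + `|b - d|.
  by rewrite -{1}(subrK b a) -addrA ler_normD.
have twice (a b : V) : 2 * `|a| <= `|a - b| + `|a + b|.
  have -> : 2 * `|a| = `|(a - b) + (a + b)|.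
    have -> : (a - b) + (a + b) = 2 *: a.
      by rewrite addrACA addNr addr0 scaler_nat mulr2n.
    by rewrite normrZ ger0_norm.
  exact: ler_normD.
have glue (a b p q : V) :
    `|p - a| <= e -> `|q - b| <= e -> `|p - q| <= e -> `|a + b| <= e -> `|a| <= 2 * e.
  have := twice a b; have := tri a p b; have := tri p q b.
  by rewrite (distrC a p); lra.
(* Each lift is computed from its column alone, so equal columns have equal lifts; the default 0 of
   [xget] is not reached inside the grid. *)
pose next (P : nat -> V) x j := xget 0 [set x' | B x' x' = P j.+1 /\ `|x - x'| <= e].
pose fix lift (P : nat -> V) j := if j is j'.+1 then next P (lift P j') j' else c.
have liftP i j : (i <= N)%N -> (j <= N)%N -> B (lift (Q i) j) (lift (Q i) j) = Q i j.
  move=> iN; elim: j => [|j IH] jN /=; first by rewrite Q0.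
  have [x' x1 x2] := xnext _ _ _ iN jN (IH (ltnW jN)).
  rewrite /next; case: xgetP => [z _ [] //|/(_ x') []]; by split.
have liftS i j : (i <= N)%N -> (j < N)%N -> `|lift (Q i) j - lift (Q i) j.+1| <= e.
  move=> iN jN /=; have [x' x1 x2] := xnext _ _ _ iN jN (liftP _ _ iN (ltnW jN)).
  rewrite /next; case: xgetP => [z _ [] //|/(_ x') []]; by split.
have lift0 P : lift P 0%N = c by [].
clearbody lift.
have near i j : (i < N)%N -> (j <= N)%N -> `|lift (Q i) j - lift (Q i.+1) j| <= e.
  move=> iN; elim: j => [|j IH] jN.
    by rewrite !lift0 subrr normr0.
  have [//|h] := xside _ _ _ _ iN jN (liftP _ _ (ltnW iN) jN) (liftP _ _ iN jN).
  have := xbig _ _ _ (ltnW iN) jN (liftP _ _ (ltnW iN) jN).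
  rewrite ltNge => /negP[].
  exact: (glue _ _ _ _ (liftS i j (ltnW iN) jN) (liftS i.+1 j iN jN) (IH (ltnW jN)) h).
have nn := leqnn N.
pose x i := lift (Q i) N.
have xy i : (i <= N)%N -> x i = y i \/ x i = - y i.
  by move=> iN; apply: sq_eq; rewrite /x liftP // QN.
(* At the end of column [i] the root is [y i] up to sign; a change of sign between neighbours would
   give a root shorter than [xbig] allows. *)
have sgn (s : R) : s ^+ 2 = 1 -> x 0%N = s *: y 0%N -> forall i, (i <= N)%N -> x i = s *: y i.
  move=> s2 x0; have s1 : `|s| = 1.
    by apply/eqP; rewrite -sqrp_eq1 // -normrX s2 normr1.
  have ss : s = 1 \/ s = - 1.
    by move/eqP: s2; rewrite sqrf_eq1 => /orP[]/eqP; [left|right].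
  elim=> [//|i IH] iN; have xi := IH (ltnW iN).
  have : x i.+1 = s *: y i.+1 \/ x i.+1 = - (s *: y i.+1).
    have [->|->] := xy _ iN; case: ss => ->; rewrite ?scaleN1r ?scale1r ?opprK; by [left|right].
  case=> // xS; exfalso.
  have := near i N iN nn; rewrite -/(x i) -/(x i.+1) xi => h1.
  have h2 : `|s *: y i.+1 - s *: y i| <= e.
    by rewrite -scalerBr normrZ s1 mul1r distrC; exact: ystep.
  have := xbig i.+1 N (x i.+1) iN nn (liftP _ _ iN nn).
  have := twice (s *: y i.+1) (s *: y i).
  move: h1; rewrite xS opprK normrN addrC => h1 h3 h4.
  have := normr_ge0 (s *: y i.+1); lra.
(* The first and last columns coincide while [y N = - y 0], so the root equals its own negative. *)
have x0N : x N = x 0%N by rewrite /x; congr (lift _ N); apply/funext => j; rewrite Qper.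
have x0big := xbig 0%N N (x 0%N) (leq0n _) nn (liftP _ _ (leq0n _) nn).
have xN : x N = - x 0%N.
  have [h|h] := xy 0%N (leq0n _).
    by rewrite (sgn 1) ?expr1n ?scale1r // yN h.
  by rewrite (sgn (-1)) ?sqrrN ?expr1n ?scaleN1r // yN h.
have : 2 * `|x 0%N| <= 0.
  by apply: le_trans (twice _ (x 0%N)) _; rewrite subrr normr0 add0r -{1}x0N xN addNr normr0.
by have := normr_ge0 (x 0%N); lra.
Qed.

End SquareRoots.

(** * Contraction of a loop of squares *)

Section SquareCone.
Local Open Scope classical_set_scope.
Local Open Scope ring_scope.
Variables (R : realType) (n : nat).
Local Notation V := 'rV[R]_n.
Variable B : {bilinear V -> V -> V}.
Hypothesis Bcomm : forall x y, B x y = B y x.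
Hypothesis nzd : forall x y, B x y = 0 -> x = 0 \/ y = 0.

(* The loop of squares of a path from [u] to [-u] is contracted along segments
   to the point [B c c]. *)
Lemma sq_cone_vanishes (c u v : V) :
  exists s t : R, [/\ 0 <= s <= 1, 0 <= t <= 1 &
    let y := (1 - 2 * t) *: u + (t * (1 - t)) *: v in
    (1 - s) *: B c c + s *: B y y = 0].
Proof.
pose y t := (1 - 2 * t) *: u + (t * (1 - t)) *: v.
pose q s t := (1 - s) *: B c c + s *: B (y t) (y t).
apply: contrapT => noz.
have q0 s t : 0 <= s <= 1 -> 0 <= t <= 1 -> q s t <> 0.
  by move=> hs ht qst; apply: noz; exists s, t.
have [k [C [k0 C0 kC]]] := bilinear_row_bounds nzd.
have yc : continuous y.
  move=> t; apply: (@cvgD _ V); apply: (@cvgZr_tmp R V).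
    apply: cvgB; first exact: cvg_cst.
    by apply: cvgM; [exact: cvg_cst|exact: cvg_id].
  apply: cvgM; first exact: cvg_id.
  by apply: cvgB; [exact: cvg_cst|exact: cvg_id].
have [m m0 qm] : exists2 m, 0 < m & forall s t, 0 <= s <= 1 -> 0 <= t <= 1 -> m <= `|q s t|.
  pose I := `[0, 1]%classic : set R.
  have cI : compact (I `*` I) by apply: compact_setX; exact: segment_compact.
  have cf : {within I `*` I, continuous (fun p : R * R => `|q p.1 p.2|)}.
    apply: continuous_subspaceT => p.
    apply: (@continuous_comp _ _ _ (fun p : R * R => q p.1 p.2) Num.norm);
      last exact: norm_continuous.
    apply: (@cvgD _ V).
      apply: (@cvgZr_tmp R V); apply: cvgB; [exact: cvg_cst|exact: cvg_fst].
    apply: (@cvgZ R V); first exact: cvg_fst.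
    apply: (@bilinear_row_continuous _ _ B (R * R)%type (fun p => y p.2)
      (fun p => y p.2)) => r;
      by apply: (@continuous_comp _ _ _ snd y); [exact: cvg_snd|exact: yc].
  have [|[s t]] := compact_EVT_min _ cI cf.
    by exists (0, 0); split; rewrite /I /= in_itv /= lexx ler01.
  rewrite inE => -[/=]; rewrite /I /= !in_itv /= => hs ht hmin.
  exists `|q s t|; first by rewrite normr_gt0; apply/eqP/q0.
  by move=> s' t' hs' ht'; apply: (hmin (s', t')); rewrite inE; split;
    rewrite /I /= in_itv.
pose Y := `|u| + `|v|; pose L := 2 * `|u| + `|v|.
have u0 := normr_ge0 u; have v0 := normr_ge0 v; have c0 := normr_ge0 c.
have Y0 : 0 <= Y by rewrite /Y; lra.
have L0 : 0 <= L by rewrite /L; lra.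
have yY t : 0 <= t <= 1 -> `|y t| <= Y.
  move=> ht; apply: le_trans (ler_normD _ _) _; rewrite !(@normrZ _ V).
  have h1 : `|1 - 2 * t| <= 1 by rewrite ler_norml; lra.
  have h2 : `|t * (1 - t)| <= 1 by rewrite ler_norml; nra.
  by rewrite /Y; apply: lerD; rewrite -[leRHS]mul1r; apply: ler_wpM2r.
have yL t t' : 0 <= t <= 1 -> 0 <= t' <= 1 -> `|y t - y t'| <= L * `|t - t'|.
  move=> ht ht'.
  have -> : y t - y t' = (t - t') *: ((- 2) *: u + (1 - t - t') *: v).
    by apply/rowP => i; rewrite !mxE; ring.
  rewrite (@normrZ _ V) mulrC; apply: ler_wpM2r => //.
  apply: le_trans (ler_normD _ _) _; 
  have n2 : `|- 2 : R| = 2 by rewrite normrN ger0_norm.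
  rewrite !(@normrZ _ V) n2 /L lerD2l.
  by rewrite -[leRHS]mul1r; apply: ler_wpM2r => //; rewrite ler_norml; lra.
(* A Lipschitz constant for [q] in each variable, and for [y]. *)
pose K := L + C * (`|c| * `|c|) + C * (Y * Y) + C * (L * (2 * Y)).
have cc0 : 0 <= C * (`|c| * `|c|) by rewrite !mulr_ge0 // ltW.
have YY0 : 0 <= C * (Y * Y) by rewrite !mulr_ge0 // ltW.
have LY0 : 0 <= C * (L * (2 * Y)) by rewrite !mulr_ge0 // ltW.
have qs s s' t : 0 <= t <= 1 -> `|q s t - q s' t| <= K * `|s - s'|.
  move=> ht; have -> : q s t - q s' t = (s - s') *: (B (y t) (y t) - B c c).
    by apply/rowP => i; rewrite !mxE; ring.
  rewrite (@normrZ _ V) mulrC; apply: ler_wpM2r => //.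
  apply: le_trans (ler_normB _ _) _.
  have [_ h1] := kC c c; have [_ h2] := kC (y t) (y t).
  have : C * (`|y t| * `|y t|) <= C * (Y * Y).
    by apply: ler_wpM2l; [exact: ltW|apply: ler_pM => //; exact: yY].
  by move=> h3; rewrite /K; lra.
have qt s t t' : 0 <= s <= 1 -> 0 <= t <= 1 -> 0 <= t' <= 1 ->
    `|q s t - q s t'| <= K * `|t - t'|.
  move=> hs ht ht'; have -> : q s t - q s t' = s *: B (y t - y t') (y t + y t').
    rewrite -(sq_sub Bcomm).
    by apply/rowP => i; rewrite !mxE; ring.
  rewrite (@normrZ _ V); have [_ h] := kC (y t - y t') (y t + y t').
  have h1 : `|y t - y t'| * `|y t + y t'| <= (L * `|t - t'|) * (2 * Y).
    apply: ler_pM => //; first exact: yL.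
    apply: le_trans (ler_normD _ _) _.
    by have := yY _ ht; have := yY _ ht'; lra.
  have h2 : C * (`|y t - y t'| * `|y t + y t'|) <= C * ((L * `|t - t'|) * (2 * Y)).
    by rewrite ler_pM2l.
  have h3 : `|s| * `|B (y t - y t') (y t + y t')| <= `|B (y t - y t') (y t + y t')|.
    by rewrite -[leRHS]mul1r; apply: ler_wpM2r => //; rewrite ger0_norm; lra.
  have tt := normr_ge0 (t - t').
  have : 0 <= (L + C * (`|c| * `|c|) + C * (Y * Y)) * `|t - t'|.
    by apply: mulr_ge0 => //; lra.
  by rewrite /K; lra.
(* With this [e], [4 C e^2 < m], so every root of a value of [q] is longer than [2 e]. *)
pose e := m / (4 * (m + C)).
have e0 : 0 < e by rewrite divr_gt0 //; lra.
have em : 4 * e * (m + C) = m by rewrite /e; field; lra.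
have eC : 4 * (e * e) * C < m by clearbody e; nra.
clearbody e.
(* By [d <= k e^2], values of [q] less than [d] apart have roots within [e] up to sign; [d <= m]
   lets [sqroot_step] apply, and [d <= e] bounds the steps of [y]. *)
pose d := Num.min (k * (e * e)) (Num.min m e).
have d0 : 0 < d by rewrite !lt_min m0 e0 !mulr_gt0.
have K0 : 0 <= K by rewrite /K; lra.
pose N := Num.bound (K / d).
have KN : K < d * N%:R.
  by rewrite mulrC -ltr_pdivrMr //; apply: archi_boundP; rewrite divr_ge0 // ltW.
have N0 : 0 < N%:R :> R by nra.
have Nh (i : nat) : `|i%:R / N%:R - i.+1%:R / N%:R| = N%:R^-1 :> R.
  rewrite -mulrBl -natr1 opprD addrA subrr add0r mulN1r normrN ger0_norm //.
  by rewrite invr_ge0 ltW.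
have Kd : K * N%:R^-1 < d by rewrite ltr_pdivrMr.
have N01 (i : nat) : (i <= N)%N -> 0 <= (i%:R / N%:R : R) <= 1.
  move=> iN; apply/andP; split; first by apply: divr_ge0; exact: ler0n.
  by rewrite ler_pdivrMr // mul1r ler_nat.
have root_big s t x : 0 <= s <= 1 -> 0 <= t <= 1 -> B x x = q s t -> 2 * e < `|x|.
  move=> hs ht hx; have := qm _ _ hs ht; rewrite -hx.
  have [_ h1] := kC x x => h2; rewrite ltNge; apply/negP => h3.
  have : `|x| * `|x| <= (2 * e) * (2 * e) by apply: ler_pM.
  by rewrite -(ler_pM2l C0); lra.
have close x x' : `|B x x - B x' x'| < k * (e * e) -> `|x - x'| <= e \/ `|x + x'| <= e.
  rewrite (sq_sub Bcomm) => h; have [h1 _] := kC (x - x') (x + x').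
  have [h2|h2] := leP `|x - x'| e; first by left.
  right; rewrite leNgt; apply/negP => h3.
  have : e * e <= `|x - x'| * `|x + x'| by apply: ler_pM; rewrite ltW.
  by rewrite -(ler_pM2l k0) => h4; lra.
have dk : d <= k * (e * e) by rewrite ge_min lexx.
have dm : d <= m by rewrite !ge_min lexx !orbT.
have de : d <= e by rewrite !ge_min lexx !orbT.
clearbody d.
(* [i] runs along the loop, [j] along the segments from [B c c] to the loop. *)
apply: (@grid_lift R n B Bcomm nzd (fun i j => q (j%:R / N%:R) (i%:R / N%:R))
   (fun i => y (i%:R / N%:R)) c e N); rewrite /=.
- exact: ltW.
- by move=> i; rewrite /q mul0r subr0 scale1r scale0r addr0.
- by move=> i; rewrite /q divff ?gt_eqF // subrr scale0r scale1r add0r.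
- move=> j; rewrite /q mul0r divff ?gt_eqF //; congr (_ + _ *: _).
  have -> : y 1 = - y 0 by apply/rowP => i; rewrite !mxE; ring.
  by rewrite linearNl linearNr opprK.
- by rewrite mul0r divff ?gt_eqF //; apply/rowP => i; rewrite !mxE; ring.
- move=> i iN; apply: le_trans (yL _ _ (N01 _ (ltnW iN)) (N01 _ iN)) _.
  rewrite Nh; apply: le_trans de; apply: le_trans (ltW Kd).
  by apply: ler_wpM2r; [rewrite invr_ge0 ltW|rewrite /K; lra].
- by move=> i j x iN jN; apply: root_big; exact: N01.
- move=> i j x iN jN hx.
  have h := qs (j%:R / N%:R) (j.+1%:R / N%:R) _ (N01 _ iN); rewrite Nh in h.
  have [|x' hx'] := sqroot_step Bcomm nzd (x := x) (p := q (j.+1%:R / N%:R) (i%:R / N%:R)).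
    rewrite hx distrC; apply: le_lt_trans h _.
    by apply: lt_le_trans (qm _ _ (N01 _ jN) (N01 _ iN)); lra.
  have [|h1|h1] := close x x'; first by rewrite hx hx'; lra.
    by exists x'.
  by exists (- x'); rewrite ?opprK // linearNl linearNr opprK.
- move=> i j x x' iN jN hx hx'; apply: close; rewrite hx hx'.
  have := qt _ _ _ (N01 _ jN) (N01 _ (ltnW iN)) (N01 _ iN); rewrite Nh => h.
  lra.
Qed.

End SquareCone.

Lemma vspace_escape (K : fieldType) (V : vectType K) (U : {vspace V}) :
  (\dim U < \dim {:V})%N -> exists v, v \notin U.
Proof.
move=> dU; have /subvPn[v _ vU] : ~~ (fullv <= U)%VS.
  by apply: contraL dU => /dimvS; rewrite -leqNgt.
by exists v.
Qed.

(** A zero of the cone over the path makes a multiple of some point [y] of the path a square root of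
    [- B c c]. Such roots lie on one line, and in dimension at least three a path from [u] to [- u]
    can avoid that line. *)
Lemma comm_bilinear_row_dim (R : realType) (n : nat)
    (B : {bilinear 'rV[R]_n -> 'rV[R]_n -> 'rV[R]_n}) :
  (forall x y, B x y = B y x) -> (forall x y, B x y = 0 -> x = 0 \/ y = 0) ->
  (n <= 2)%N.
Proof.
move=> Bcomm nzd; rewrite leqNgt; apply/negP => n3.
have dimV : \dim {:'rV[R]_n} = n by rewrite dimvf /dim /= mul1n.
have [|c cU] := @vspace_escape R 'rV[R]_n 0%VS; first by rewrite dimv0 dimV (ltn_trans _ n3).
have c0 : c != 0 by rewrite memv0 in cU.
have [d [d0 hd]] : exists d, d != 0 /\ forall d', B d' d' = - B c c -> d' = d \/ d' = - d.
  have [[d hd]|nod] := pselect (exists d, B d d = - B c c).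
    exists d; split; last by move=> d' hd'; apply: (sq_eq Bcomm nzd); rewrite hd hd'.
    apply: contraNneq c0 => de; move: hd; rewrite de (linear0l B) => /eqP.
    by rewrite eq_sym oppr_eq0 => /eqP/nzd[] ->.
  (* If there is no such root, any non-zero vector serves as [d]. *)
  by exists c; split=> // d' hd'; case: nod; exists d'.
have [|u uU] := @vspace_escape R 'rV[R]_n <[d]>%VS.
  by rewrite dimV dim_vline; case: (d != 0); exact: ltn_trans n3.
have [|v vU] := @vspace_escape R 'rV[R]_n (<[d]> + <[u]>)%VS.
  rewrite dimV (leq_ltn_trans (leq_of_leqif (dimv_add_leqif _ _))) //.
  by rewrite !dim_vline; case: (d != 0); case: (u != 0) => //; exact: ltn_trans n3.
have [s [t []]] := sq_cone_vanishes Bcomm nzd c u v.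
set y := _ + _ => hs ht /= h.
(* At its ends the path is at [u] or [- u]; in between it has a non-zero component along [v]. *)
have yd k : y <> k *: d.
  move=> yk; have [t1|t1] := eqVneq (t * (1 - t)) 0.
    have t2 : (1 - 2 * t) != 0 by apply/eqP; nra.
    move/negP: uU; apply; apply/vlineP; exists ((1 - 2 * t)^-1 * k).
    by rewrite -scalerA -yk /y t1 scale0r addr0 scalerA mulVf // scale1r.
  move/negP: vU; apply.
  have -> : v = ((t * (1 - t))^-1 * k) *: d + (- ((t * (1 - t))^-1 * (1 - 2 * t))) *: u.
    rewrite -scalerA -yk /y scalerDr !scalerA mulVf // scale1r scaleNr addrAC.
    by rewrite subrr add0r.
  by apply: memv_add; apply: memvZ; exact: memv_line.
have y0 : y <> 0 by have := yd 0; rewrite scale0r.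
have c0' : B c c <> 0 by move=> /nzd[] ce; rewrite ce eqxx in c0.
have s0 : s != 0.
  apply/eqP => s0; move: h; rewrite s0 subr0 scale1r scale0r addr0; exact: c0'.
have s1 : s != 1.
  by apply/eqP => s1; move: h; rewrite s1 subrr scale1r scale0r add0r => /nzd[].
have s01 : 0 < 1 - s by rewrite subr_gt0 lt_neqAle s1; case/andP: hs.
have s00 : 0 < s by rewrite lt_neqAle eq_sym s0; case/andP: hs.
(* Scaling by [r] turns [s y^2 = - (1 - s) c^2] into [(r y)^2 = - c^2]. *)
pose r := Num.sqrt (s / (1 - s)).
have r2 : r * r = s / (1 - s) by rewrite -expr2 sqr_sqrtr // ltW // divr_gt0.
have r0 : r != 0 by rewrite gt_eqF // sqrtr_gt0 divr_gt0.
have := hd (r *: y); rewrite (linearZl_LR B) (linearZr_LR B) /= scalerA r2 => hry.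
have /hry : (s / (1 - s)) *: B y y = - B c c.
  apply/eqP; rewrite -addr_eq0 addrC mulrC -scalerA.
  have -> : s *: B y y = - ((1 - s) *: B c c).
    by apply/eqP; rewrite -addr_eq0 addrC h.
  by rewrite scalerN scalerA mulVf ?gt_eqF // scale1r subrr.
case=> e; [apply: (yd r^-1)|apply: (yd (- r^-1))].
  by rewrite -e scalerA mulVf // scale1r.
by rewrite scaleNr -scalerN -e scalerA mulVf // scale1r.
Qed.

(** * Hopf's bound for commutative subalgebras *)

Section Coordinates.
Import VectorInternalTheory.
Variables (R : realType) (A : vectType R) (mul : {bilinear A -> A -> A}).
Variable U : {vspace A}.

(** The product of [U] in coordinates, because norm and topology live on row vectors; on a
    subalgebra the projection [vsproj] changes nothing. *)
Definition coord_mul (x y : 'rV[R]_(dim (subvs_of U))) : 'rV[R]_(dim (subvs_of U)) :=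
  v2r (vsproj U (mul (vsval (r2v x)) (vsval (r2v y)))).

Lemma coord_mul_bilinear : bilinear_for *:%R *:%R coord_mul.
Proof.
split=> z a x y; rewrite /coord_mul !(linearP, linearD, linearZ) //=.
by rewrite linearDl linearZl_LR /= !linearP.
Qed.

HB.instance Definition _ := bilinear_isBilinear.Build R _ _ _ _ _ coord_mul
  coord_mul_bilinear.

Lemma comm_subalgebra_dim :
  is_subalgebra mul U ->
  {in U &, forall x y, mul x y = mul y x} ->
  {in U &, forall x y, mul x y = 0 -> x = 0 \/ y = 0} ->
  (\dim U <= 2)%N.
Proof.
move=> subU commU nzdU.
have -> : \dim U = dim (subvs_of U) by [].
apply: (comm_bilinear_row_dim (B := coord_mul)) => x y; rewrite /= /coord_mul.
  by rewrite commU ?subvsP.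
move=> /(canRL (@v2rK _ _)); rewrite linear0 => /(congr1 vsval).
rewrite vsprojK ?subU ?subvsP // linear0 => /nzdU[]; rewrite ?subvsP // => h; [left|right];
  apply: (can_inj (@r2vK _ _)); rewrite linear0; apply: val_inj; rewrite /= h //.
Qed.
End Coordinates.

Section Generated.
Variables (R : realType) (A : vectType R) (mul : {bilinear A -> A -> A}).

Lemma division_algebra_nzd : division_algebra mul ->
  forall x y, mul x y = 0 -> x = 0 \/ y = 0.
Proof.
move=> divA x y xy0; have [->|x0] := eqVneq x 0; first by left.
have [/bij_inj inj _] := divA x x0; right.
by apply: inj; rewrite xy0 linear0r.
Qed.

(** A subalgebra of least dimension containing [x] is generated by [x], as intersecting it with the
    others shows; so it is commutative and Hopf's bound applies. *)
Lemma comm_subalgebra_mem (x : A) : division_algebra mul -> power_commutative mul ->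
  exists U : {vspace A}, [/\ is_subalgebra mul U, x \in U, (\dim U <= 2)%N &
    {in U &, forall y z, mul y z = mul z y}].
Proof.
move=> divA pcA; have nzd := division_algebra_nzd divA.
pose P n := `[< exists U : {vspace A}, [/\ is_subalgebra mul U, x \in U & \dim U = n] >].
have exP : exists n, P n.
  by exists (\dim {:A}); apply/asboolP; exists fullv; split=> [y z _ _||//]; rewrite memvf.
case: (ex_minnP exP) => n /asboolP[U [subU xU dU]] minU.
have genU y : y \in U -> in_generated mul x y.
  move=> yU W subW xW; have : (U :&: W)%VS == U.
    rewrite eqEdim capvSl dU minU //; apply/asboolP.
    exists (U :&: W)%VS; split=> //; last by rewrite memv_cap xU xW.
    move=> a b; rewrite !memv_cap => /andP[aU aW] /andP[bU bW].
    by rewrite subU ?subW.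
  by move=> /eqP/capv_idPl/subvP; apply.
have commU : {in U &, forall y z, mul y z = mul z y}.
  by move=> y z yU zU; apply: (pcA x); exact: genU.
exists U; split=> //; apply: comm_subalgebra_dim commU _ => //.
by move=> y z _ _; exact: nzd.
Qed.

End Generated.

(** * Linear forms and polynomial functions *)

Section LinearAlgebra.
Variables (K : fieldType) (V : vectType K).

Definition linear_form (f : V -> K) :=
  (forall x y, f (x + y) = f x + f y) /\ (forall a x, f (a *: x) = a * f x).

Definition indep2 (x y : V) := forall a b, a *: x + b *: y = 0 -> a = 0 /\ b = 0.

Definition indep3 (x y z : V) :=
  forall a b c, a *: x + b *: y + c *: z = 0 -> [/\ a = 0, b = 0 & c = 0].

Definition span2 (x y z : V) := exists s t, z = s *: x + t *: y.

Lemma linear_formN f x : linear_form f -> f (- x) = - f x.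
Proof. by case=> _ fZ; rewrite -scaleN1r fZ mulN1r. Qed.

Lemma linear_form0 f : linear_form f -> f 0 = 0.
Proof. by case=> _ fZ; rewrite -(scale0r 0) fZ mul0r. Qed.

Lemma coord_linear_form n (X : n.-tuple V) i : linear_form (coord X i).
Proof. by split=> [x y|a x]; [rewrite linearD|rewrite linearZ]. Qed.

(** Coordinate forms separate points; vector identities thus become scalar ones, open to [ring] and
    [lra]. *)
Lemma linear_form_ext (x y : V) : (forall f, linear_form f -> f x = f y) -> x = y.
Proof.
move=> h; rewrite (coord_vbasis (memvf x)) (coord_vbasis (memvf y)).
by apply: eq_bigr => i _; rewrite (h _ (coord_linear_form _ i)).
Qed.

Lemma indep2_span2 x y : x != 0 -> (forall k, y <> k *: x) -> indep2 x y.
Proof.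
move=> x0 xy a b h; have b0 : b = 0.
  apply/eqP/negPn/negP => b0; apply: (xy (- (b^-1 * a))).
  move/eqP: h; rewrite addrC addr_eq0 => /eqP h.
  by rewrite scaleNr -scalerA -scalerN -h scalerA mulVf // scale1r.
by move: h; rewrite b0 scale0r addr0 => /eqP; rewrite scaler_eq0 (negPf x0) orbF => /eqP.
Qed.

Lemma indep3_span2 x y z : indep2 x y -> ~ span2 x y z -> indep3 x y z.
Proof.
move=> xy nz a b c h; have c0 : c = 0.
  apply/eqP/negPn/negP => c0; apply: nz; exists (- (c^-1 * a)), (- (c^-1 * b)).
  move/eqP: h; rewrite addrC addr_eq0 => /eqP h.
  rewrite !scaleNr -opprD -!scalerA -scalerDr -scalerN -h scalerA mulVf //.
  by rewrite scale1r.
by move: h; rewrite c0 scale0r addr0 => /xy[-> ->].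
Qed.

Lemma indep3_free x y z : indep3 x y z -> free [:: x; y; z].
Proof.
move=> h; have: free (in_tuple [:: x; y; z]); last by [].
apply/freeP => k; rewrite !big_ord_recl big_ord0 addr0 addrA.
move=> /h[k0 k1 k2] [[|[|[|//]]] i3].
- by rewrite -[RHS]k0; congr k; exact: val_inj.
- by rewrite -[RHS]k1; congr k; exact: val_inj.
- by rewrite -[RHS]k2; congr k; exact: val_inj.
Qed.

Lemma indep3_dim (U : {vspace V}) x y z :
  x \in U -> y \in U -> z \in U -> indep3 x y z -> (3 <= \dim U)%N.
Proof.
move=> xU yU zU /indep3_free; rewrite /free => /eqP /= <-; apply: dimvS.
by apply/span_subvP => t; rewrite !inE => /or3P[] /eqP->.
Qed.

Hypothesis dimV : \dim {:V} = 4%N.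

Lemma indep3_basis x y z : indep3 x y z -> exists w f0 f1 f2 f3,
  [/\ [/\ linear_form f0, linear_form f1, linear_form f2 & linear_form f3],
      forall t, t = f0 t *: x + f1 t *: y + f2 t *: z + f3 t *: w
    & forall a b c d, let t := a *: x + b *: y + c *: z + d *: w in
      [/\ f0 t = a, f1 t = b, f2 t = c & f3 t = d]].
Proof.
move=> h; have fr := indep3_free h.
have [|w wU] := @vspace_escape K V <<[:: x; y; z]>>.
  by move: fr; rewrite /free => /eqP->; rewrite dimV.
(* The new vector comes first, so [x], [y], [z] have indices 1, 2, 3. *)
pose X := [tuple w; x; y; z].
have fX : free X by rewrite free_cons wU.
have bX : basis_of fullv X.
  by rewrite basisEfree fX subvf dimV.
exists w, (coord X (inord 1)), (coord X (inord 2)), (coord X (inord 3)), (coord X 0).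
have dec t : t = coord X (inord 1) t *: x + coord X (inord 2) t *: y +
    coord X (inord 3) t *: z + coord X 0 t *: w.
  rewrite {1}(coord_basis bX (memvf t)) !big_ord_recl big_ord0 addr0.
  rewrite addrC !addrA; congr (_ *: _ + _ *: _ + _ *: _ + _ *: _); congr (coord X _ t);
  by apply: val_inj; rewrite /= ?inordK.
split=> //; first by split; exact: coord_linear_form.
have c1 i j : (i < 4)%N -> (j < 4)%N -> coord X (inord i) X`_j = (j == i)%:R.
  move=> i4 j4; rewrite -{1}(inordK j4) coord_free //.
  by rewrite -(inj_eq val_inj) /= !inordK // eq_sym.
move=> a b c d t.
have c0 : (0 : 'I_4) = inord 0 by apply: val_inj; rewrite /= inordK.
rewrite c0 /t !linearD !linearZ /=.
rewrite -[x]/(X`_1) -[y]/(X`_2) -[z]/(X`_3) -[w]/(X`_0) !c1 //=.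
by split; rewrite !(mulr0, mulr1, addr0, add0r).
Qed.

End LinearAlgebra.

(** * Polynomial functions and the identity principle *)

Section PolynomialFunctions.
Variables (R : realType) (V : lmodType R).

(* Polynomial along every affine line, which is all that the identity
   principle below needs. *)
Definition polyfun (f : V -> R) :=
  forall x y, exists p : {poly R}, forall t, f (x + t *: y) = p.[t].

Lemma polyfunD f g : polyfun f -> polyfun g -> polyfun (fun x => f x + g x).
Proof.
move=> pf pg x y; have [p hp] := pf x y; have [q hq] := pg x y.
by exists (p + q) => t; rewrite hornerD hp hq.
Qed.

Lemma polyfunM f g : polyfun f -> polyfun g -> polyfun (fun x => f x * g x).
Proof.
move=> pf pg x y; have [p hp] := pf x y; have [q hq] := pg x y.
by exists (p * q) => t; rewrite hornerM hp hq.
Qed.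

Lemma polyfun_cst c : polyfun (fun=> c).
Proof. by move=> x y; exists c%:P => t; rewrite hornerC. Qed.

Lemma polyfunB f g : polyfun f -> polyfun g -> polyfun (fun x => f x - g x).
Proof.
move=> pf pg; rewrite (_ : (fun _ => _) = fun x => f x + (-1) * g x).
  by apply: polyfunD => //; apply: polyfunM => //; exact: polyfun_cst.
by apply/funext => x; rewrite mulN1r.
Qed.

Lemma poly_eq0_horner (p : {poly R}) : (forall t, p.[t] = 0) -> p = 0.
Proof.
move=> p0; apply/eqP/negPn/negP => pn.
pose rs := [seq i%:R | i <- iota 0 (size p)] : seq R.
have rr : all (root p) rs by apply/allP => t _; rewrite /root p0.
have ur : uniq rs.
  by rewrite map_inj_uniq ?iota_uniq // => i j /eqP; rewrite eqr_nat => /eqP.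
by have := max_poly_roots pn rr ur; rewrite size_map size_iota ltnn.
Qed.

(** If [f x] and [g y] are non-zero, then on the line through [x] and [y] both restrict to non-zero
    polynomials, whose product cannot vanish. *)
Lemma polyfun_mul_eq0 f g : polyfun f -> polyfun g ->
  (forall x, f x * g x = 0) -> (forall x, f x = 0) \/ (forall x, g x = 0).
Proof.
move=> pf pg fg0; apply: contrapT => /not_orP[/existsNP[x fx] /existsNP[y gy]].
have [p hp] := pf x (y - x); have [q hq] := pg x (y - x).
have : p * q = 0.
  by apply: poly_eq0_horner => t; rewrite hornerM -hp -hq fg0.
move/eqP; rewrite mulf_eq0 => /orP[] /eqP z.
  by apply: fx; rewrite -[x]addr0 -(scale0r (y - x)) hp z horner0.
by apply: gy; rewrite -[y](subrKC x) -[y - x]scale1r hq z horner0.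
Qed.

End PolynomialFunctions.

Lemma linear_form_polyfun (R : realType) (A : vectType R) (f : A -> R) :
  linear_form f -> polyfun f.
Proof.
move=> lf x y; exists ((f x)%:P + (f y) *: 'X) => t.
by rewrite lf.1 lf.2 !hornerE mulrC.
Qed.

Lemma quadratic_polyfun (R : realType) (A : vectType R) (mul : {bilinear A -> A -> A})
    (f : A -> R) : linear_form f -> polyfun (fun x => f (mul x x)).
Proof.
move=> lf x y.
exists ((f (mul x x))%:P + (f (mul x y) + f (mul y x)) *: 'X + (f (mul y y)) *: 'X^2) => t.
transitivity (f (mul x x) + (f (mul x y) + f (mul y x)) * t + f (mul y y) * t ^+ 2).
  rewrite (linearDl mul) !(linearDr mul) !(linearZl_LR mul) !(linearZr_LR mul) /=.
  by rewrite !lf.1 !lf.2; ring.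
by rewrite !hornerE.
Qed.

Lemma quartic_coef (R : realType) (c0 c1 c2 c3 c4 : R) :
  (forall d : R, c0 + c1 * d + c2 * d ^+ 2 + c3 * d ^+ 3 + c4 * d ^+ 4 = 0) ->
  [/\ c1 = 0, c2 = 0, c3 = 0 & c4 = 0].
Proof.
by move=> h; have := h 0; have := h 1; have := h (-1); have := h 2; have := h (-2) => *; split; lra.
Qed.

(** * Quadratic maps with values on a quadric *)

Section Quadrics.
Variable R : realType.
Variables (l nu s0 s1 s2 s3 p0 p1 p2 p3 q0 q1 q2 q3 r0 r1 r2 r3 : R).

(* For [x = a h + b u + c v + d z], with [h, u, v] a normalised basis of a
   pencil, these are [psi x] and the coordinates of [psi x *: x - sq x] in
   [h, u, v]; the parameters are the coordinates of [jd h z], [jd u z],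
   [jd v z] and [sq z]. *)
Definition psi (a b c d : R) := s0 * a + s1 * b + s2 * c + s3 * d.
Definition eps0 (a b c d : R) := a * psi a b c d
  - (a * a - b * b - c * c + nu * a * b) - d * (p0 * a + p1 * b + p2 * c + p3 * d).
Definition eps1 (a b c d : R) := b * psi a b c d - l * a * b
  - d * (q0 * a + q1 * b + q2 * c + q3 * d).
Definition eps2 (a b c d : R) := c * psi a b c d - l * a * c
  - d * (r0 * a + r1 * b + r2 * c + r3 * d).

Hypothesis onQ : forall a b c d, (1 - l) * eps0 a b c d ^+ 2 + nu * eps0 a b c d * eps1 a b c d
  = eps1 a b c d ^+ 2 + eps2 a b c d ^+ 2.

(** At [(0, s2, - s1, 0)] the form [psi] vanishes and only [eps0 = s1^2 + s2^2] survives, so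
    [s1 = s2 = 0]; then [(0, 1, 0, 0)] gives [1 - l = 0]. *)
Lemma quadric_generic : l != 1 -> False.
Proof.
move=> l1; have l1' : 1 - l != 0 by rewrite subr_eq0 eq_sym.
have := onQ 0 s2 (- s1) 0; have -> : eps1 0 s2 (- s1) 0 = 0 by rewrite /eps1 /psi; ring.
have -> : eps2 0 s2 (- s1) 0 = 0 by rewrite /eps2 /psi; ring.
have -> : eps0 0 s2 (- s1) 0 = s1 ^+ 2 + s2 ^+ 2 by rewrite /eps0 /psi; ring.
rewrite mulr0 !expr0n /= !addr0 => /eqP; rewrite mulf_eq0 (negPf l1') /= sqrf_eq0.
rewrite paddr_eq0 ?sqr_ge0 // !sqrf_eq0 => /andP[/eqP s10 /eqP s20].
have := onQ 0 1 0 0; rewrite /eps0 /eps1 /eps2 /psi s10 s20.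
by move=> h; move/eqP: l1'; apply; lra.
Qed.

(** Comparing coefficients leaves [s1 = 0], where [eps1] and [eps2] vanish, or [s1 = nu], where
    squares are completed by shifting [b] and [c] by [m d] and [n d]. *)
Lemma quadric_degenerate : l = 1 -> nu != 0 ->
  (forall a b c d, eps1 a b c d = 0 /\ eps2 a b c d = 0) \/
  exists m n, forall a b c d, [/\ eps0 a b c d = (b + m * d) ^+ 2 + (c + n * d) ^+ 2,
     eps1 a b c d = nu * (b + m * d) ^+ 2 & eps2 a b c d = nu * (b + m * d) * (c + n * d)].
Proof.
move=> l1 nu0.
have H a b c d : nu * eps0 a b c d * eps1 a b c d = eps1 a b c d ^+ 2 + eps2 a b c d ^+ 2.
  by rewrite -onQ l1 subrr mul0r add0r.
have s20 : s2 = 0.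
  apply/eqP; rewrite -sqrf_eq0; apply/eqP.
  by have := H 0 0 1 0; rewrite /eps0 /eps1 /eps2 /psi l1; lra.
have s01 : s0 = 1.
  apply/eqP; rewrite -subr_eq0 -sqrf_eq0; apply/eqP.
  by have := H 1 0 1 0; rewrite /eps0 /eps1 /eps2 /psi l1 s20; lra.
(* The coefficients of [d] in [eps0], [eps1] and [eps2]. *)
pose M a b c := a * s3 - (p0 * a + p1 * b + p2 * c).
pose L1 a b c := b * s3 - (q0 * a + q1 * b + q2 * c).
pose L2 a b c := c * s3 - (r0 * a + r1 * b + r2 * c).
have [s10|s10] : s1 = 0 \/ s1 = nu.
  have : s1 * (nu - s1) = 0.
    by have := H 0 1 1 0; rewrite /eps0 /eps1 /eps2 /psi l1 s20; lra.
  move/eqP; rewrite mulf_eq0 subr_eq0 => /orP[] /eqP; first by left.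
  by right.
- left; pose N a b c := b ^+ 2 + c ^+ 2 - nu * a * b.
  have C a b c : [/\ nu * N a b c * L1 a b c = 0,
     nu * (- N a b c * q3 + M a b c * L1 a b c) - L1 a b c ^+ 2 - L2 a b c ^+ 2 = 0,
     nu * (- M a b c * q3 - p3 * L1 a b c) + 2 * L1 a b c * q3 + 2 * L2 a b c * r3 = 0 &
     nu * p3 * q3 - q3 ^+ 2 - r3 ^+ 2 = 0].
    apply: (@quartic_coef _ 0) => d.
    have := H a b c d; rewrite /eps0 /eps1 /eps2 /psi l1 s20 s01 s10 /N /M /L1 /L2; lra.
  have L1b : s3 - q1 = 0.
    by apply: (mulfI nu0); have [] := C 0 1 0; rewrite /N /L1; lra.
  have L1c : q2 = 0.
    by apply: (mulfI nu0); have [] := C 0 0 1; rewrite /N /L1; lra.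
  have L1a : q0 = 0.
    by apply: (mulfI nu0); have [] := C 1 0 1; rewrite /N /L1 L1c; lra.
  have L10 a b c : L1 a b c = 0 by rewrite /L1 L1a L1c (_ : q1 = s3); [ring|lra].
  have L2a : r0 = 0.
    apply/eqP; rewrite -sqrf_eq0; apply/eqP.
    by have [_ + _ _] := C 1 0 0; rewrite L10 /N /L2; lra.
  have L2b : r1 = 0.
    apply: (mulfI nu0); apply/eqP; rewrite mulr0 -sqrf_eq0; apply/eqP.
    by have [_ + _ _] := C 1 nu 0; rewrite L10 /N /L2 L2a; lra.
  have q30 : q3 = 0.
    apply: (mulfI nu0).
    by have [_ + _ _] := C 0 1 0; rewrite L10 /N /L2 L2a L2b; lra.
  have L2c : s3 - r2 = 0.
    apply/eqP; rewrite -sqrf_eq0; apply/eqP.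
    by have [_ + _ _] := C 0 0 1; rewrite L10 /N /L2 L2a L2b q30; lra.
  have r30 : r3 = 0.
    apply/eqP; rewrite -sqrf_eq0; apply/eqP.
    by have [_ _ _] := C 0 0 1; rewrite q30; lra.
  move=> a b c d; rewrite /eps1 /eps2 /psi l1 s20 s01 s10 L1c L1a L2a L2b q30 r30.
  have -> : q1 = s3 by lra.
  have -> : r2 = s3 by lra.
  by split; ring.
right.
have C a b c : [/\ nu * (b ^+ 2 * (nu * M a b c - L1 a b c) + c ^+ 2 * L1 a b c
      - 2 * b * c * L2 a b c) = 0,
    nu * (- (b ^+ 2 + c ^+ 2) * q3 + M a b c * L1 a b c - nu * b ^+ 2 * p3)
      - L1 a b c ^+ 2 + 2 * nu * b ^+ 2 * q3 - L2 a b c ^+ 2 + 2 * nu * b * c * r3 = 0,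
    nu * (- M a b c * q3 - p3 * L1 a b c) + 2 * L1 a b c * q3 + 2 * L2 a b c * r3 = 0 &
    nu * p3 * q3 - q3 ^+ 2 - r3 ^+ 2 = 0].
  apply: (@quartic_coef _ 0) => d.
  have := H a b c d; rewrite /eps0 /eps1 /eps2 /psi l1 s20 s01 s10 /M /L1 /L2; lra.
have C1 a b c : b ^+ 2 * (nu * M a b c - L1 a b c) + c ^+ 2 * L1 a b c
      - 2 * b * c * L2 a b c = 0.
  by apply: (mulfI nu0); have [-> _ _ _] := C a b c; rewrite mulr0.
(* The coefficients of [c d] and [b d] in [eps2] must be [nu m] and [nu n]. *)
pose m := (s3 - r2) / nu; pose n := - r1 / nu.
have mE : s3 - r2 = nu * m by rewrite /m; field.
have nE : r1 = - (nu * n) by rewrite /n; field.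
have := C1 0 1 0; have := C1 0 0 1; have := C1 1 1 0; have := C1 1 0 1.
have := C1 0 1 1; have := C1 0 1 (-1); have := C1 1 1 1.
rewrite /M /L1 /L2 => e1 e2 e3 e4 e5 e6 e7.
clearbody m n.
have hr2 : r2 = s3 - nu * m by lra.
have hr0 : r0 = 0 by lra.
have hq0 : q0 = 0 by lra.
have hq2 : q2 = 0 by lra.
have hq1 : q1 = s3 - 2 * nu * m by lra.
have hM a b c : M a b c = 2 * m * b + 2 * n * c.
  have -> : M a b c = a * (s3 - p0) - p1 * b - p2 * c by rewrite /M; ring.
  have -> : s3 - p0 = 0 by apply: (mulfI nu0); lra.
  have -> : p1 = - (2 * m) by apply: (mulfI nu0); lra.
  have -> : p2 = - (2 * n) by apply: (mulfI nu0); lra.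
  by ring.
have hL1 a b c : L1 a b c = 2 * nu * m * b by rewrite /L1 hq0 hq1 hq2; ring.
have hL2 a b c : L2 a b c = nu * (m * c + n * b) by rewrite /L2 hr0 hr2 nE; ring.
have C2 a b c : - (b ^+ 2 + c ^+ 2) * q3 + M a b c * L1 a b c - nu * b ^+ 2 * p3
      - nu * (2 * m * b) ^+ 2 + 2 * b ^+ 2 * q3 - nu * (m * c + n * b) ^+ 2 + 2 * b * c * r3 = 0.
  apply: (mulfI nu0); have [_ + _ _] := C a b c.
  by rewrite hL1 hL2 mulr0; lra.
have := C2 0 0 1; have := C2 0 1 0; have := C2 0 1 1; rewrite !hM !hL1 => f1 f2 f3.
have hq3 : q3 = - (nu * m ^+ 2) by lra.
have hp3 : p3 = - (m ^+ 2 + n ^+ 2) by apply: (mulfI nu0); lra.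
have hr3 : r3 = - (nu * m * n) by lra.
exists m, n => a b c d.
have -> : eps0 a b c d = b ^+ 2 + c ^+ 2 + d * M a b c - d ^+ 2 * p3.
  by rewrite /eps0 /M /psi s20 s01 s10; ring.
have -> : eps1 a b c d = nu * b ^+ 2 + d * L1 a b c - d ^+ 2 * q3.
  by rewrite /eps1 /L1 /psi s20 s01 s10 l1; ring.
have -> : eps2 a b c d = nu * b * c + d * L2 a b c - d ^+ 2 * r3.
  by rewrite /eps2 /L2 /psi s20 s01 s10 l1; ring.
by rewrite hM hL1 hL2 hp3 hq3 hr3; split; ring.
Qed.
End Quadrics.

Lemma cubic_root (R : realType) (a b c : R) : exists t, t ^+ 3 + a * t ^+ 2 + b * t + c = 0.
Proof.
pose p : {poly R} := 'X^3 + a *: 'X^2 + b *: 'X + c%:P.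
have pE t : p.[t] = t ^+ 3 + a * t ^+ 2 + b * t + c by rewrite /p !hornerE.
pose M := 1 + `|a| + `|b| + `|c|.
have := ler_norm a; have := ler_norm b; have := ler_norm c.
have := ler_normr a (- a); have := lerNnormlW (lexx `|a|).
have := lerNnormlW (lexx `|b|); have := lerNnormlW (lexx `|c|).
move=> c1 b1 a1 _ c2 b2 a2.
have M1 : 1 <= M by rewrite /M; have := normr_ge0 a; have := normr_ge0 b; have := normr_ge0 c; lra.
have [||t _ /rootP] := @poly_ivt R p (- M) M; first lra.
  have aM : `|a| = M - 1 - `|b| - `|c| by rewrite /M; lra.
  have b0 := normr_ge0 b; have c0 := normr_ge0 c; have a0 := normr_ge0 a.
  rewrite !pE; clearbody M.
  have MM : M <= M ^+ 2 by nra.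
  have key : `|a| * M ^+ 2 + `|b| * M + `|c| <= M ^+ 3 by nra.
  have ha : - `|a| * M ^+ 2 <= a * M ^+ 2 <= `|a| * M ^+ 2 by nra.
  have hb : - `|b| * M <= b * M <= `|b| * M by nra.
  by apply/andP; split; nra.
by rewrite pE => h; exists t.
Qed.

(** * Planes and pencils of subalgebras *)

Section PowerCommutative.
Variables (R : realType) (A : vectType R) (mul : {bilinear A -> A -> A}).
Hypothesis dimA : \dim {:A} = 4%N.
Hypothesis divA : division_algebra mul.
Hypothesis pcA : power_commutative mul.

Definition sq x := mul x x.
(** The polarisation of [sq]: twice the Jordan product. *)
Definition jd x y := mul x y + mul y x.

Lemma jdDl x y z : jd (x + y) z = jd x z + jd y z.
Proof. by rewrite /jd linearDl linearDr addrACA. Qed.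
Lemma jdC x y : jd x y = jd y x.
Proof. by rewrite /jd addrC. Qed.
Lemma jdDr x y z : jd z (x + y) = jd z x + jd z y.
Proof. by rewrite !(jdC z) jdDl. Qed.
Lemma jdZl a x z : jd (a *: x) z = a *: jd x z.
Proof. by rewrite /jd linearZl_LR linearZr_LR scalerDr. Qed.
Lemma jdZr a x z : jd z (a *: x) = a *: jd z x.
Proof. by rewrite !(jdC z) jdZl. Qed.
Lemma jdNl x z : jd (- x) z = - jd x z.
Proof. by rewrite -scaleN1r jdZl scaleN1r. Qed.
Lemma jdNr x z : jd z (- x) = - jd z x.
Proof. by rewrite !(jdC z) jdNl. Qed.
Lemma sqD x y : sq (x + y) = sq x + jd x y + sq y.
Proof. by rewrite /sq /jd linearDl !linearDr !addrA. Qed.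
Lemma sqZ a x : sq (a *: x) = a ^+ 2 *: sq x.
Proof. by rewrite /sq linearZl_LR linearZr_LR scalerA. Qed.
Lemma sqN x : sq (- x) = sq x.
Proof. by rewrite -scaleN1r sqZ sqrrN expr1n scale1r. Qed.
Lemma jdxx x : jd x x = 2 *: sq x.
Proof. by rewrite /jd -/(sq x) scaler_nat mulr2n. Qed.

Definition jE := (jdDl, jdDr, jdZl, jdZr, jdNl, jdNr, jdxx, sqD, sqZ, sqN).

(** Reduces a vector identity to its image under an arbitrary linear form; [vech h] does the same to
    the hypothesis [h]. *)
Ltac vec := let f := fresh "f" in let lf := fresh "lf" in
  apply: linear_form_ext; intros f lf;
  rewrite ?(lf.1, lf.2, linear_formN _ lf, linear_form0 lf).

Ltac vech h := let f := fresh "f" in let lf := fresh "lf" in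
  apply: linear_form_ext; intros f lf; move/(congr1 f): h;
  rewrite ?(lf.1, lf.2, linear_formN _ lf, linear_form0 lf) => h.

Lemma sq_eq0 x : sq x = 0 -> x = 0.
Proof. by move/(division_algebra_nzd divA) => []. Qed.

(** * The plane of an element and its square *)

Definition collinear_sq x := exists k, sq x = k *: x.

(** Otherwise [sq u = k u] and [sq v = l v], and adding the squares of [l u + k v] and [l u - k v]
    shows that the second one is zero. *)
Lemma indep2_not_collinear_sq u v : indep2 u v ->
  exists a b, ~ collinear_sq (a *: u + b *: v).
Proof.
move=> uv; apply: contrapT => nop.
have {}nop a b : collinear_sq (a *: u + b *: v).
  by apply: contrapT => h; apply: nop; exists a, b.
have cmp a b a' b' : a *: u + b *: v = a' *: u + b' *: v -> a = a' /\ b = b'.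
  move=> h; have [/eqP + /eqP] : a - a' = 0 /\ b - b' = 0.
    by apply: uv; rewrite !scalerBl addrACA h -opprD subrr.
  by rewrite !subr_eq0 => /eqP-> /eqP->.
have [k ku] := nop 1 0; rewrite scale1r scale0r addr0 in ku.
have [l lv] := nop 0 1; rewrite scale1r scale0r add0r in lv.
have [m hm] := nop l k; have [n hn] := nop l (- k).
have k0 : k != 0.
  apply/eqP => k0; move: ku; rewrite k0 scale0r => /sq_eq0 u0.
  have [] := uv 1 0; first by rewrite u0 scaler0 scale0r addr0.
  by move/eqP; rewrite oner_eq0.
have l0 : l != 0.
  apply/eqP => l0; move: lv; rewrite l0 scale0r => /sq_eq0 v0.
  have [] := uv 0 1; first by rewrite v0 scaler0 scale0r addr0.
  by move=> _ /eqP; rewrite oner_eq0.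
have : (2 * (l ^+ 2 * k)) *: u + (2 * (k ^+ 2 * l)) *: v =
   ((m + n) * l) *: u + ((m - n) * k) *: v.
  have := congr2 +%R hm hn; rewrite !jE ku lv => h.
  by vech h; lra.
move=> /cmp[h1 h2].
have e1 : m + n = 2 * (l * k) by apply: (mulIf l0); lra.
have e2 : m - n = 2 * (l * k) by apply: (mulIf k0); lra.
have n0 : n = 0 by lra.
move: hn; rewrite n0 scale0r => /sq_eq0 /uv[l00 _].
by rewrite l00 eqxx in l0.
Qed.

(* A plane closed under squares is a commutative subalgebra: it is spanned by
   [x] and [sq x] for some [x]. *)
Lemma plane_jd_eq0 a b x y : indep2 a b ->
  span2 a b (sq a) -> span2 a b (sq b) -> span2 a b (jd a b) ->
  span2 a b x -> span2 a b y -> jd x y = 0 -> x = 0 \/ y = 0.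
Proof.
move=> ab [s1 [t1 sa]] [s2 [t2 sb]] [s3 [t3 sab]] [x1 [x2 hx]] [y1 [y2 hy]] jxy.
have [c [d cd]] := indep2_not_collinear_sq ab.
have [U [subU wU _ commU]] := comm_subalgebra_mem (c *: a + d *: b) divA pcA.
have sU := subU _ _ wU wU; rewrite -/(sq _) in sU.
(* [g] and [h] are the coordinates of the square of [w = c a + d b]; since [c h - d g] is non-zero,
   [a] and [b] are recovered from [w] and its square. *)
pose g := c ^+ 2 * s1 + c * d * s3 + d ^+ 2 * s2.
pose h := c ^+ 2 * t1 + c * d * t3 + d ^+ 2 * t2.
have sw : sq (c *: a + d *: b) = g *: a + h *: b.
  rewrite !jE sa sb sab; vec; rewrite /g /h; ring.
have D0 : c * h - d * g != 0.
  apply/eqP => D0; apply: cd.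
  have [c0|c0] := eqVneq c 0; last first.
    exists (g / c); rewrite sw.
    have -> : h = d * g / c by apply: (mulfI c0); have -> : c * (d * g / c) = d * g by [field]; lra.
    by vec; field.
  have [d0|d0] := eqVneq d 0.
    by exists 0; rewrite c0 d0 !scale0r addr0 /sq (linear0l mul).
  exists (h / d); rewrite sw; have -> : g = c * h / d.
    by apply: (mulfI d0); have -> : d * (c * h / d) = c * h by [field]; lra.
  by vec; field.
have aU : a \in U.
  have -> : a = (c * h - d * g)^-1 *: (h *: (c *: a + d *: b) - d *: sq (c *: a + d *: b)).
    by rewrite sw; vec; field.
  by rewrite memvZ // memvB // memvZ.
have bU : b \in U.
  have -> : b = (c * h - d * g)^-1 *: (c *: sq (c *: a + d *: b) - g *: (c *: a + d *: b)).
    by rewrite sw; vec; field.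
  by rewrite memvZ // memvB // memvZ.
have xU : x \in U by rewrite hx memvD // memvZ.
have yU : y \in U by rewrite hy memvD // memvZ.
move: jxy; rewrite /jd (commU y x) // -mulr2n -scaler_nat => /eqP.
rewrite scaler_eq0 pnatr_eq0 /= => /eqP; exact: division_algebra_nzd.
Qed.

(** A subalgebra of dimension at most two contains [x] and [sq x]; it is their span if they are
    independent, and otherwise [sq x] is a multiple of [x]. *)
Lemma sq_in_plane x y : span2 x (sq x) y -> span2 x (sq x) (sq y).
Proof.
move=> [s [t ->]].
have [U [subU xU dU commU]] := comm_subalgebra_mem x divA pcA.
have sU : sq x \in U by exact: subU.
have [[k sx]|npx] := pselect (collinear_sq x).
  exists 0, ((s + t * k) ^+ 2); rewrite {1}sx scale0r add0r.
  by rewrite scalerA -scalerDl sqZ.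
have x0 : x != 0.
  by apply/eqP => x0; apply: npx; exists 0; rewrite x0 scale0r /sq (linear0l mul).
have xs : indep2 x (sq x) by apply: indep2_span2 => // k sk; apply: npx; exists k.
apply: contrapT => h; have := indep3_span2 xs h.
have sy : sq (s *: x + t *: sq x) \in U by apply: subU; rewrite memvD // memvZ.
by move/(indep3_dim xU sU sy); rewrite leqNgt ltnS dU.
Qed.

Lemma jd_in_plane x y z : span2 x (sq x) y -> span2 x (sq x) z ->
  span2 x (sq x) (jd y z).
Proof.
move=> hy hz; have hyz : span2 x (sq x) (y + z).
  case: hy => [s [t ->]]; case: hz => [s' [t' ->]].
  by exists (s + s'), (t + t'); vec; ring.
have [s1 [t1 h1]] := sq_in_plane hy; have [s2 [t2 h2]] := sq_in_plane hz.
have [s3 [t3]] := sq_in_plane hyz; rewrite sqD h1 h2 => h.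
exists (s3 - s1 - s2), (t3 - t1 - t2); vech h; lra.
Qed.

(* An idempotent is a zero of a cubic form on the plane of [x] and [sq x]. *)
Lemma idempotent_in_plane x : x != 0 -> exists k, [/\ k != 0, sq k = k & span2 k x (sq x)].
Proof.
move=> x0; have idem (y : A) (m : R) : y != 0 -> sq y = m *: y ->
    m != 0 /\ sq (m^-1 *: y) = m^-1 *: y.
  move=> y0 hy; have m0 : m != 0.
    by apply/eqP => m0; move: hy; rewrite m0 scale0r => /sq_eq0/eqP; rewrite (negPf y0).
  by rewrite sqZ hy; split=> //; vec; field.
have [[m hm]|npx] := pselect (collinear_sq x).
  have [m0 hi] := idem _ _ x0 hm; exists (m^-1 *: x); split=> //.
    by rewrite scaler_eq0 invr_eq0 negb_or m0.
  by exists 0, m; rewrite hm scale0r add0r.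
have px : span2 x (sq x) x by exists 1, 0; rewrite scale1r scale0r addr0.
have ps : span2 x (sq x) (sq x) by exists 0, 1; rewrite scale1r scale0r add0r.
have [c1 [c2 hc]] := jd_in_plane px ps.
have [d1 [d2 hd]] := sq_in_plane ps.
(* This choice of [t] makes the square of [t x + sq x] a multiple of it. *)
have [t ht] := cubic_root c2 (d2 - c1) (- d1).
pose y := t *: x + sq x.
have y0 : y != 0.
  apply/eqP => y0; apply: npx; exists (- t).
  by vech y0; lra.
have hy : sq y = (d2 + t * c2 + t ^+ 2) *: y.
  rewrite /y !jE hc hd; vec.
  have e : d1 = t ^+ 3 + c2 * t ^+ 2 + (d2 - c1) * t by lra.
  by rewrite e; ring.
have [m0 hi] := idem _ _ y0 hy.
exists ((d2 + t * c2 + t ^+ 2)^-1 *: y); split=> //.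
  by rewrite scaler_eq0 invr_eq0 negb_or m0.
exists (d2 + t * c2 + t ^+ 2), (- t); rewrite scalerA mulfV // scale1r /y.
by vec; ring.
Qed.

(** * Pencils and their normal form *)

Lemma indep3_eq (u v w : A) a b c a' b' c' : indep3 u v w ->
  a *: u + b *: v + c *: w = a' *: u + b' *: v + c' *: w ->
  [/\ a = a', b = b' & c = c'].
Proof.
move=> uvw h; have [] := uvw (a - a') (b - b') (c - c'); first by vech h; lra.
by move=> /eqP + /eqP + /eqP; rewrite !subr_eq0 => /eqP-> /eqP-> /eqP->.
Qed.

(* The planes through the idempotent [h] inside the span of [h], [u], [v] are
   all subalgebras. *)
Definition pencil h u v := [/\ indep3 h u v, sq h = h &
  forall b c, let w := b *: u + c *: v in span2 h w (sq w) /\ span2 h w (jd h w)].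

Definition pencil_eig h u v (l n1 n2 : R) :=
  jd h u = l *: u + n1 *: h /\ jd h v = l *: v + n2 *: h.

(** Modulo [h], [jd h] preserves every line of the pencil, so it is a scalar [l]; if [l = 0], then
    [jd h (2 u - n1 h) = 0] inside a plane, giving a zero divisor. *)
Lemma pencil_eigP h u v : pencil h u v ->
  exists l n1 n2, l != 0 /\ pencil_eig h u v l n1 n2.
Proof.
case=> i3 hh hp.
have [[s [t su]] [n1 [l1 ju]]] := hp 1 0; rewrite scale0r addr0 scale1r in su ju.
have [_ [n2 [l2 jv]]] := hp 0 1; rewrite scale0r add0r scale1r in jv.
have [_ [n3 [l3 juv]]] := hp 1 1; rewrite !scale1r in juv.
have h1 : (n1 + n2) *: h + l1 *: u + l2 *: v = n3 *: h + l3 *: u + l3 *: v.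
  by move: juv; rewrite !jE ju jv => e; vech e; lra.
have [_ e1 e2] := indep3_eq i3 h1.
exists l1, n1, n2; split; last first.
  by split; [rewrite ju addrC|rewrite jv addrC e1 e2].
apply/eqP => l0.
have hu : indep2 h u.
  by move=> a b ab; have [] := i3 a b 0; [rewrite scale0r addr0|].
have : jd h (2 *: u - n1 *: h) = 0.
  by rewrite !jE ju hh l0; vec; ring.
case/(plane_jd_eq0 hu _ _ _ _ _).
- by exists 1, 0; rewrite hh; vec; ring.
- by exists s, t.
- by exists n1, l1.
- by exists 1, 0; vec; ring.
- by exists (- n1), 2; vec; ring.
- by move=> h0; have [] := hu 1 0; [rewrite h0; vec; ring|lra].
- by move=> e; have [] := hu (- n1) 2; [vech e; lra|lra].
Qed.

(** In such a basis [sq (a h + b u + c v)] is [(a^2 - b^2 - c^2 + n a b) h + l a (b u + c v)]. *)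
Definition pencil_normal h u v (l n : R) :=
  [/\ indep3 h u v, sq h = h, jd h u = l *: u + n *: h & jd h v = l *: v] /\
  [/\ sq u = - h, sq v = - h & jd u v = 0].

Lemma indep3_change (h u v : A) a b c a' b' c' : indep3 h u v -> b * c' - c * b' != 0 ->
  indep3 h (a *: h + b *: u + c *: v) (a' *: h + b' *: u + c' *: v).
Proof.
move=> i3 d0 p q r e.
have [] := i3 (p + q * a + r * a') (q * b + r * b') (q * c + r * c').
  by vech e; lra.
move=> e0 e1 e2.
have q0 : q = 0.
  apply: (mulIf d0); rewrite mul0r; move: (congr1 ( *%R c') e1) (congr1 ( *%R b') e2); lra.
have r0 : r = 0.
  apply: (mulIf d0); rewrite mul0r; move: (congr1 ( *%R c) e1) (congr1 ( *%R b) e2); lra.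
by split=> //; move: e0; rewrite q0 r0; lra.
Qed.

Definition pencil_form h u v (l n1 n2 k11 k12 k22 : R) :=
  [/\ indep3 h u v, sq h = h & pencil_eig h u v l n1 n2] /\
  [/\ sq u = - (k11 *: h), sq v = - (k22 *: h) & jd u v = - ((2 * k12) *: h)].

(** Subtracting [(m1 / l) h] from [u] removes the [u]-component of its square, likewise for [v]; the
    squares of [u0 + v0] and [u0 - v0] then show that [jd u0 v0] is a multiple of [h]. *)
Lemma pencil_formP (h u v : A) l n1 n2 : pencil h u v -> l != 0 -> pencil_eig h u v l n1 n2 ->
  exists u' v' n1' n2' k11 k12 k22, pencil_form h u' v' l n1' n2' k11 k12 k22.
Proof.
case=> i3 hh hp l0 [ju jv].
have [[s1 [m1 su]] _] := hp 1 0; rewrite scale0r addr0 scale1r in su.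
have [[s2 [m2 sv]] _] := hp 0 1; rewrite scale0r add0r scale1r in sv.
pose u0 := (- (m1 / l)) *: h + 1 *: u + 0 *: v.
pose v0 := (- (m2 / l)) *: h + 0 *: u + 1 *: v.
have i30 : indep3 h u0 v0 by apply: indep3_change => //; rewrite mulr1 mul0r subr0 oner_neq0.
have u0E : u0 = u - (m1 / l) *: h by rewrite /u0; vec; ring.
have v0E : v0 = v - (m2 / l) *: h by rewrite /v0; vec; ring.
have ju0 : jd h u0 = l *: u0 + (n1 + m1 - 2 * (m1 / l)) *: h.
  by rewrite u0E !jE ju hh; vec; field.
have jv0 : jd h v0 = l *: v0 + (n2 + m2 - 2 * (m2 / l)) *: h.
  by rewrite v0E !jE jv hh; vec; field.
have su0 : sq u0 = - ((m1 / l * (n1 - m1 / l) - s1) *: h).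
  by rewrite u0E !jE (jdC u h) ju su hh; vec; field.
have sv0 : sq v0 = - ((m2 / l * (n2 - m2 / l) - s2) *: h).
  by rewrite v0E !jE (jdC v h) jv sv hh; vec; field.
have sqw b c : exists s t, sq (b *: u0 + c *: v0) = s *: h + t *: (b *: u0 + c *: v0).
  have [[s [t sw]] [s' [t' jw]]] := hp b c.
  pose d := - (b * (m1 / l) + c * (m2 / l)).
  have -> : b *: u0 + c *: v0 = (b *: u + c *: v) + d *: h.
    by rewrite u0E v0E /d; vec; ring.
  exists (s + d * s' + d ^+ 2 - (t + d * t') * d), (t + d * t').
  by rewrite sqD jdZr sqZ (jdC _ h) jw sw hh; vec; ring.
clearbody u0 v0.
have [s [t e1]] := sqw 1 1; have [s' [t' e2]] := sqw 1 (- 1).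
rewrite !jE su0 sv0 in e1 e2.
set k1 := (_ - s1) in su0 e1 e2 *; set k2 := (_ - s2) in sv0 e1 e2 *.
have e3 : (s + s' + 2 * k1 + 2 * k2) *: h + (t + t') *: u0 + (t - t') *: v0 = 0.
  have e := congr2 +%R e1 e2; vech e; lra.
have [_ t1 t2] := i30 _ _ _ e3.
have t0 : t = 0 by lra.
exists u0, v0, (n1 + m1 - 2 * (m1 / l)), (n2 + m2 - 2 * (m2 / l)), k1, (- (s + k1 + k2) / 2), k2.
split=> //; split=> //.
by rewrite t0 in e1; vech e1; lra.
Qed.

(** If the form takes a value [- r^2] at [w = b u + c v], then [w - r h] and [w + r h] are zero
    divisors in the plane of [h] and [w]. *)
Lemma pencil_form_pos h u v l n1 n2 k11 k12 k22 : pencil_form h u v l n1 n2 k11 k12 k22 ->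
  forall b c, (b != 0) || (c != 0) -> 0 < k11 * b ^+ 2 + 2 * k12 * b * c + k22 * c ^+ 2.
Proof.
case=> -[i3 hh [ju jv]] [su sv juv] b c bc.
set k := k11 * b ^+ 2 + 2 * k12 * b * c + k22 * c ^+ 2.
pose w := b *: u + c *: v.
have sw : sq w = - (k *: h) by rewrite /w !jE su sv juv /k; vec; ring.
have jw : jd h w = l *: w + (b * n1 + c * n2) *: h by rewrite /w !jE ju jv; vec; ring.
have hw : indep2 h w.
  move=> p q e; have [|p0 q1 q2] := i3 p (q * b) (q * c).
    by move: e; rewrite /w => e; vech e; lra.
  split=> //; case/orP: bc => x0; apply: (mulIf x0); rewrite mul0r //.
rewrite ltNge; apply/negP => k0; pose r := Num.sqrt (- k).
have r2 : r ^+ 2 = - k by rewrite sqr_sqrtr // oppr_ge0.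
clearbody w.
have : jd (w - r *: h) (w + r *: h) = 0.
  rewrite !jE (jdC w h) jw sw hh; vec.
  have : r * r = - k by rewrite -r2 expr2.
  nra.
case/(plane_jd_eq0 hw _ _ _ _ _).
- by exists 1, 0; rewrite hh; vec; ring.
- by exists (- k), 0; rewrite sw; vec; ring.
- by exists (b * n1 + c * n2), l; rewrite jw addrC.
- by exists (- r), 1; vec; ring.
- by exists r, 1; vec; ring.
- by move=> e; have [] := hw (- r) 1; [vech e; lra|lra].
- by move=> e; have [] := hw r 1; [vech e; lra|lra].
Qed.

(** The form is positive definite, so it has an orthonormal basis whose second vector is killed by
    the functional [(n1, n2)]. *)
Lemma pencil_normalP h u v l n1 n2 : pencil h u v -> l != 0 -> pencil_eig h u v l n1 n2 ->
  exists u' v' n, pencil_normal h u' v' l n.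
Proof.
move=> hp l0 /(pencil_formP hp l0) {hp} [{}u [{}v [{}n1 [{}n2 [k11 [k12 [k22 hf]]]]]]].
have pos := pencil_form_pos hf; case: hf => -[i3 hh [ju jv]] [su sv juv].
have [p [q [pq n12]]] : exists p q, (p != 0) || (q != 0) /\ q * n1 - p * n2 = 0.
  have [n0|n0] := boolP ((n1 != 0) || (n2 != 0)).
    by exists n1, n2; split=> //; ring.
  exists 1, 0; rewrite oner_neq0; split=> //.
  by move: n0; rewrite negb_or !negbK => /andP[/eqP-> /eqP->]; ring.
pose K b c := k11 * b ^+ 2 + 2 * k12 * b * c + k22 * c ^+ 2.
have pq2 : p ^+ 2 + q ^+ 2 != 0.
  by rewrite paddr_eq0 ?sqr_ge0 // !sqrf_eq0 negb_and.
have kv : 0 < K q (- p) by apply: pos; rewrite oppr_eq0 orbC.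
(* [(q, - p)] spans the kernel of [(n1, n2)]; Gram-Schmidt gives the other vector *)
pose m := (k11 * p * q + k12 * (q * q - p * p) - k22 * p * q) / K q (- p).
pose b := p - m * q; pose c := q + m * p.
have ku : 0 < K b c.
  apply: pos; apply/negPn/negP; rewrite negb_or !negbK => /andP[/eqP b0 /eqP c0].
  have : p * b + q * c = 0 by rewrite b0 c0; ring.
  by rewrite /b /c => e; move/eqP: pq2; apply; rewrite -e; ring.
pose ru := (Num.sqrt (K b c))^-1; pose rv := (Num.sqrt (K q (- p)))^-1.
have ru2 : ru ^+ 2 * K b c = 1 by rewrite /ru exprVn sqr_sqrtr ?ltW // mulVf // gt_eqF.
have rv2 : rv ^+ 2 * K q (- p) = 1.
  by rewrite /rv exprVn sqr_sqrtr ?ltW // mulVf // gt_eqF.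
have ru0 : ru != 0 by rewrite invr_eq0 gt_eqF // sqrtr_gt0.
have rv0 : rv != 0 by rewrite invr_eq0 gt_eqF // sqrtr_gt0.
have mK : m * K q (- p) = k11 * p * q + k12 * (q * q - p * p) - k22 * p * q.
  by rewrite /m mulfVK // gt_eqF.
clearbody m.
exists (0 *: h + (ru * b) *: u + (ru * c) *: v),
  (0 *: h + (rv * q) *: u + (- (rv * p)) *: v), (ru * (b * n1 + c * n2)).
split; split=> //.
- apply: indep3_change => //.
  have -> : ru * b * - (rv * p) - ru * c * (rv * q) = - (ru * rv * (p ^+ 2 + q ^+ 2)).
    by rewrite /b /c; ring.
  by rewrite oppr_eq0 !mulf_neq0.
- by rewrite !jE ju jv hh; vec; ring.
- have e : (rv * q * n1) *: h = (rv * p * n2) *: h.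
    by congr (_ *: _); rewrite -!mulrA; congr (_ * _); lra.
  by rewrite !jE ju jv hh; vech e; lra.
- have e : (ru ^+ 2 * K b c) *: h = h by rewrite ru2 scale1r.
  rewrite !jE ?(jdC v u) ?(jdC v h) ?(jdC u h) su sv juv ju jv hh.
  by rewrite /K in e *; vech e; lra.
- have e : (rv ^+ 2 * K q (- p)) *: h = h by rewrite rv2 scale1r.
  rewrite !jE ?(jdC v u) ?(jdC v h) ?(jdC u h) su sv juv ju jv hh.
  by rewrite /K in e *; vech e; lra.
- have e : (2 * ru * rv * (k11 * p * q + k12 * (q * q - p * p) - k22 * p * q
      - m * K q (- p))) *: h = 0.
    by rewrite mK subrr mulr0 scale0r.
  rewrite !jE ?(jdC v u) ?(jdC v h) ?(jdC u h) su sv juv ju jv hh.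
  by rewrite /K /b /c in e *; vech e; lra.
Qed.

(** * From a pencil to an omnipresent idempotent *)

(* Every plane of [x] and [sq x] contains such an [e]. *)
Definition omnipresent e := forall x, span2 e x (sq x).

Ltac polyfun := repeat first [ apply: polyfunB | apply: polyfunD | apply: polyfunM
  | exact: polyfun_cst | by apply: linear_form_polyfun | by apply: quadratic_polyfun ].

(* The element [psi x *: x - sq x] of the plane of [x] lies in the span of
   [h], [u], [v], so its square is a multiple of it; this says that it lies on
   a quadric, unless it is a multiple of [h]. *)
Lemma pencil_normal_quadric h u v l n : pencil_normal h u v l n ->
  exists z s0 s1 s2 s3 p0 p1 p2 p3 q0 q1 q2 q3 r0 r1 r2 r3,
  let p := psi s0 s1 s2 s3 in
  let e0 := eps0 n s0 s1 s2 s3 p0 p1 p2 p3 in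
  let e1 := eps1 l s0 s1 s2 s3 q0 q1 q2 q3 in
  let e2 := eps2 l s0 s1 s2 s3 r0 r1 r2 r3 in
  [/\ forall a b c d, a *: h + b *: u + c *: v + d *: z = 0 ->
       [/\ a = 0, b = 0, c = 0 & d = 0],
      forall x, exists a b c d, x = a *: h + b *: u + c *: v + d *: z,
      forall a b c d, let x := a *: h + b *: u + c *: v + d *: z in
        sq x = p a b c d *: x - (e0 a b c d *: h + e1 a b c d *: u + e2 a b c d *: v)
    & (forall a b c d, e1 a b c d = 0 /\ e2 a b c d = 0) \/
      forall a b c d, (1 - l) * e0 a b c d ^+ 2 + n * e0 a b c d * e1 a b c d
         = e1 a b c d ^+ 2 + e2 a b c d ^+ 2].
Proof.
move=> [[i3 hh ju jv] [su sv juv]].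
have [z [f0 [f1 [f2 [f3 [[lf0 lf1 lf2 lf3] dec ev]]]]]] := indep3_basis dimA i3.
have sz := dec (sq z); have jhz := dec (jd h z).
have juz := dec (jd u z); have jvz := dec (jd v z).
exists z, (f3 (jd h z)), (f3 (jd u z)), (f3 (jd v z)), (f3 (sq z)).
exists (f0 (jd h z)), (f0 (jd u z)), (f0 (jd v z)), (f0 (sq z)).
exists (f1 (jd h z)), (f1 (jd u z)), (f1 (jd v z)), (f1 (sq z)).
exists (f2 (jd h z)), (f2 (jd u z)), (f2 (jd v z)), (f2 (sq z)).
set p := psi _ _ _ _; set e0 := eps0 _ _ _ _ _ _ _ _ _.
set e1 := eps1 _ _ _ _ _ _ _ _ _; set e2 := eps2 _ _ _ _ _ _ _ _ _ => /=.
have cmp a b c d a' b' c' d' :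
    a *: h + b *: u + c *: v + d *: z = a' *: h + b' *: u + c' *: v + d' *: z ->
    [/\ a = a', b = b', c = c' & d = d'].
  move=> e; have [a1 b1 c1 d1] := ev a b c d; have [a2 b2 c2 d2] := ev a' b' c' d'.
  by split; [rewrite -[LHS]a1 e|rewrite -[LHS]b1 e|rewrite -[LHS]c1 e|rewrite -[LHS]d1 e].
have sqx a b c d : sq (a *: h + b *: u + c *: v + d *: z) =
    p a b c d *: (a *: h + b *: u + c *: v + d *: z)
    - (e0 a b c d *: h + e1 a b c d *: u + e2 a b c d *: v).
  rewrite !jE hh ju jv su sv juv sz jhz juz jvz.
  by rewrite /p /e0 /e1 /e2 /eps0 /eps1 /eps2 /psi; vec; ring.
split=> //.
- move=> a b c d e; apply: cmp; rewrite e; vec; ring.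
- by move=> x; exists (f0 x), (f1 x), (f2 x), (f3 x); exact: dec.
pose g i x : R := i (f0 x) (f1 x) (f2 x) (f3 x).
pose Q a b c d := (1 - l) * (e0 a b c d * e0 a b c d) + n * e0 a b c d * e1 a b c d
   - e1 a b c d * e1 a b c d - e2 a b c d * e2 a b c d.
have pe0 : polyfun (g e0) by rewrite /g /e0 /eps0 /psi; polyfun.
have pe1 : polyfun (g e1) by rewrite /g /e1 /eps1 /psi; polyfun.
have pe2 : polyfun (g e2) by rewrite /g /e2 /eps2 /psi; polyfun.
have pQ : polyfun (g Q) by rewrite /g /Q; polyfun.
have pf3 : polyfun f3 by exact: linear_form_polyfun.
have f3z : f3 z <> 0.
  have [_ _ _] := ev 0 0 0 1; rewrite !scale0r !add0r scale1r => ->.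
  by move/eqP; rewrite oner_eq0.
(* For [y = psi x x - sq x], [sq y] is in the span of [x] and [y]; as [y] has no [z]-component,
   [f3 x != 0] forces [sq y = - t y]. Eliminating [t] gives both equations. *)
have key x : f3 x * (g e1 x * g Q x) = 0 /\ f3 x * (g e2 x * g Q x) = 0.
  rewrite /g; have hx := dec x.
  set a := f0 x in hx *; set b := f1 x in hx *; set c := f2 x in hx *; set d := f3 x in hx *.
  have [s [t]] : span2 x (sq x) (sq (p a b c d *: x - sq x)).
    by apply: sq_in_plane; exists (p a b c d), (- 1); rewrite scaleN1r.
  have -> : p a b c d *: x - sq x = e0 a b c d *: h + e1 a b c d *: u + e2 a b c d *: v.
    by rewrite {2}hx sqx -hx; vec; ring.
  rewrite [X in t *: sq X]hx sqx [X in s *: X]hx.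
  rewrite !jE hh ju jv su sv juv => e.
  have [h0 h1 h2 h3] : [/\
      e0 a b c d ^+ 2 + n * e0 a b c d * e1 a b c d - e1 a b c d ^+ 2 - e2 a b c d ^+ 2
        = (s + t * p a b c d) * a - t * e0 a b c d,
      l * e0 a b c d * e1 a b c d = (s + t * p a b c d) * b - t * e1 a b c d,
      l * e0 a b c d * e2 a b c d = (s + t * p a b c d) * c - t * e2 a b c d &
      0 = (s + t * p a b c d) * d].
    by apply: cmp; vech e; lra.
  have [-> | d0] := eqVneq d 0; first by rewrite !mul0r.
  have st : s + t * p a b c d = 0 by apply: (mulIf d0); rewrite mul0r -h3.
  rewrite st mul0r sub0r in h0 h1 h2.
  have QE : Q a b c d = - (t * e0 a b c d) - l * e0 a b c d ^+ 2.
    by rewrite -h0 /Q; ring.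
  rewrite QE; split.
    have -> : d * (e1 a b c d * (- (t * e0 a b c d) - l * e0 a b c d ^+ 2)) =
      d * e0 a b c d * (- (t * e1 a b c d) - l * e0 a b c d * e1 a b c d) by ring.
    by rewrite h1; ring.
  have -> : d * (e2 a b c d * (- (t * e0 a b c d) - l * e0 a b c d ^+ 2)) =
      d * e0 a b c d * (- (t * e2 a b c d) - l * e0 a b c d * e2 a b c d) by ring.
  by rewrite h2; ring.
have gabcd i a b c d : g i (a *: h + b *: u + c *: v + d *: z) = i a b c d.
  by rewrite /g; have [-> -> -> ->] := ev a b c d.
have vanish i : polyfun (g i) -> (forall x, f3 x * (g i x * g Q x) = 0) ->
    (forall a b c d, i a b c d = 0) \/ (forall a b c d, Q a b c d = 0).
  move=> pi hi; have [/(_ z) //|hi2] := polyfun_mul_eq0 pf3 (polyfunM pi pQ) hi.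
  have [h0|h0] := polyfun_mul_eq0 pi pQ hi2; [left|right] => a b c d.
    by rewrite -gabcd h0.
  by rewrite -(gabcd Q) h0.
have Qok : (forall a b c d, Q a b c d = 0) -> forall a b c d,
    (1 - l) * e0 a b c d ^+ 2 + n * e0 a b c d * e1 a b c d
         = e1 a b c d ^+ 2 + e2 a b c d ^+ 2.
  by move=> hQ a b c d; have := hQ a b c d; rewrite /Q; lra.
have [h1|/Qok] := vanish _ pe1 (fun x => (key x).1); last by right.
have [h2|/Qok] := vanish _ pe2 (fun x => (key x).2); last by right.
by left.
Qed.

(** By [quadric_generic] each [psi x *: x - sq x] is a multiple of [h]. *)
Lemma pencil_omnipresent_generic h u v l n1 n2 : pencil h u v -> pencil_eig h u v l n1 n2 ->
  l != 0 -> l != 1 -> omnipresent h.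
Proof.
move=> hp he l0 l1; have [u' [v' [n hn]]] := pencil_normalP hp l0 he.
have [z [s0 [s1 [s2 [s3 [p0 [p1 [p2 [p3 [q0 [q1 [q2 [q3 [r0 [r1 [r2 [r3 []]]]]]]]]]]]]]]]]] := pencil_normal_quadric hn.
move=> _ dec sqx [e12|onQ] x; last by case: (quadric_generic onQ l1).
have [a [b [c [d ->]]]] := dec x; rewrite sqx.
have [-> ->] := e12 a b c d.
by eexists; eexists; rewrite !scale0r !addr0 addrC -scaleNr.
Qed.

Lemma pencil_omnipresent h u v : pencil h u v -> exists e, [/\ e != 0, sq e = e & omnipresent e].
Proof.
move=> hp; have [i3 hh _] := hp.
have nz (e x y : A) : indep3 e x y -> e != 0.
  move=> ie; apply/eqP => e0; have [] := ie 1 0 0; first by rewrite e0; vec; ring.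
  by move/eqP; rewrite oner_eq0.
have [l [n1 [n2 [l0 he]]]] := pencil_eigP hp.
have [l1|l1] := eqVneq l 1; last first.
  by exists h; split; [exact: nz i3|done|exact: pencil_omnipresent_generic hp he l0 l1].
have [u' [v' [n hn]]] := pencil_normalP hp l0 he.
have [z [s0 [s1 [s2 [s3 [p0 [p1 [p2 [p3 [q0 [q1 [q2 [q3 [r0 [r1 [r2 [r3 []]]]]]]]]]]]]]]]]] := pencil_normal_quadric hn.
set p := psi _ _ _ _; set e0 := eps0 _ _ _ _ _ _ _ _ _.
set e1 := eps1 _ _ _ _ _ _ _ _ _; set e2 := eps2 _ _ _ _ _ _ _ _ _.
move=> i4 dec sqx alt.
have flat : (forall a b c d, e1 a b c d = 0 /\ e2 a b c d = 0) ->
    exists e, [/\ e != 0, sq e = e & omnipresent e].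
  move=> e12; exists h; split; [exact: nz i3|done|] => x.
  have [a [b [c [d ->]]]] := dec x; rewrite sqx.
  have [-> ->] := e12 a b c d.
  by eexists; eexists; rewrite !scale0r !addr0 addrC -scaleNr.
case: alt => [//|onQ].
(* For [l = 1] and [n = 0] the quadric equation says that a sum of two squares is zero. *)
have [n0|n0] := eqVneq n 0.
  apply: flat => a b c d; have := onQ a b c d.
  move=> h1; have : e1 a b c d ^+ 2 + e2 a b c d ^+ 2 == 0.
    by rewrite -h1 l1 n0 subrr !mul0r addr0.
  by rewrite paddr_eq0 ?sqr_ge0 // !sqrf_eq0 => /andP[/eqP ? /eqP ?]; split.
have [/flat//|[m [k mk]]] := quadric_degenerate onQ l1 n0.
case: hn => -[i3' _ ju jv] [su sv juv].
(* on the span of [h], [u'] and [z - k v'] the vector [psi x *: x - sq x] is a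
   multiple of [e] *)
pose e := h + n *: u'; pose z' := z - k *: v'.
have se : sq e = e by rewrite /e !jE hh ju su l1; vec; ring.
have jeh : jd e h = (1 + n ^+ 2) *: h + 1 *: e.
  by rewrite /e !jE (jdC u') ju hh l1; vec; ring.
have sqw a b d : sq (a *: h + b *: u' + d *: z') =
   p a b (- (k * d)) d *: (a *: h + b *: u' + d *: z') - (b + m * d) ^+ 2 *: e.
  have -> : a *: h + b *: u' + d *: z' = a *: h + b *: u' + (- (k * d)) *: v' + d *: z.
    by rewrite /z'; vec; ring.
  rewrite sqx; have [] := mk a b (- (k * d)) d.
  by rewrite -/(e0 _ _ _ _) -/(e1 _ _ _ _) -/(e2 _ _ _ _) => -> -> ->;
     rewrite /e; vec; ring.
have ie : indep3 e h z'.
  move=> a b c habc; have [|h1 h2 _ h4] := i4 (a + b) (a * n) (- (c * k)) c.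
    by rewrite /e /z' in habc; vech habc; lra.
  have a0 : a = 0 by apply: (mulIf n0); rewrite mul0r.
  by split=> //; move: h1; rewrite a0 add0r.
have pe : pencil e h z'.
  split=> // b d w.
  have [t [s sw]] : exists t s, sq w = t *: w + s *: e.
    exists (p b 0 (- (k * d)) d), (- (0 + m * d) ^+ 2).
    have -> : w = b *: h + 0 *: u' + d *: z' by rewrite /w; vec; ring.
    by rewrite sqw scaleNr.
  have [t' [s' sw']] : exists t s, sq (w + e) = t *: (w + e) + s *: e.
    exists (p (b + 1) n (- (k * d)) d), (- (n + m * d) ^+ 2).
    have -> : w + e = (b + 1) *: h + n *: u' + d *: z' by rewrite /w /e; vec; ring.
    by rewrite sqw scaleNr.
  split; first by exists s, t; rewrite sw addrC.
  exists (t' + s' - s - 1), (t' - t).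
  by move: sw'; rewrite sqD sw se (jdC w) => h1; vech h1; lra.
(* The eigenvalue at [e] is [1 + n^2], which differs from 1. *)
have [le [m1 [m2 [le0 hee]]]] := pencil_eigP pe.
have lE : le = 1 + n ^+ 2.
  have h1 : m1 *: e + le *: h + 0 *: z' = 1 *: e + (1 + n ^+ 2) *: h + 0 *: z'.
    by have := hee.1; rewrite jeh => h1; vech h1; lra.
  by have [_ ->] := indep3_eq ie h1.
exists e; split; [exact: nz ie|done|].
apply: (pencil_omnipresent_generic pe hee le0).
by rewrite lE -subr_eq0 addrC addKr sqrf_eq0.
Qed.

(** * Construction of pencils from idempotents *)

(** Squares suffice, since [jd h w = sq (h + w) - sq h - sq w]. *)
Lemma pencil_span h u v : indep3 h u v -> sq h = h ->
  (forall a b c, exists s t, sq (a *: h + b *: u + c *: v) =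
     s *: h + t *: (a *: h + b *: u + c *: v)) -> pencil h u v.
Proof.
move=> i3 hh hs; split=> // b c w.
have [s [t]] := hs 0 b c; have [s' [t']] := hs 1 b c.
have -> : 0 *: h + b *: u + c *: v = w by rewrite /w; vec; ring.
have -> : 1 *: h + b *: u + c *: v = h + w by rewrite /w; vec; ring.
move=> e' e; split; first by exists s, t.
exists (s' + t' - s - 1), (t' - t).
by rewrite sqD hh e in e'; vech e'; lra.
Qed.

(* For [x = a e + b f] the element [sq x] is [(a + b) x - a b h], so [h] lies
   in the planes of all these [x]. *)
Lemma pencil_of_nonadjacent e f : sq e = e -> sq f = f -> indep2 e f ->
  ~ span2 e f (jd e f) -> exists h u v, pencil h u v.
Proof.
move=> se sf ef nadj; have i3 := indep3_span2 ef nadj.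
pose h := e + f - jd e f.
have ih : indep3 h e f.
  move=> a b c habc; have [|h1 h2 h3] := i3 (a + b) (a + c) (- a).
    by rewrite /h in habc; vech habc; lra.
  by split; lra.
have sx a b : sq (a *: e + b *: f) = (a + b) *: (a *: e + b *: f) - (a * b) *: h.
  by rewrite !jE se sf /h; vec; ring.
clearbody h.
have inpl a b : a * b != 0 -> let x := a *: e + b *: f in
    [/\ span2 x (sq x) x, span2 x (sq x) h &
        forall y, span2 x (sq x) y -> exists s t, y = s *: h + (t * a) *: e + (t * b) *: f].
  move=> ab x; have := ab; rewrite mulf_eq0 negb_or => /andP[a0 b0]; split.
  - by exists 1, 0; vec; ring.
  - by exists ((a * b)^-1 * (a + b)), (- (a * b)^-1); rewrite /x sx; vec; field; rewrite ?a0 ?b0.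
  - move=> y [s [t ->]]; exists (- (t * (a * b))), (s + t * (a + b)).
    by rewrite /x sx; vec; ring.
(* The directions [e + f], [e + 2 f], [e - f]: the planes of the first two meet in the line of [h],
   which thus contains [sq h]; all three make [jd h] scalar modulo [h]. *)
have ab1 : 1 * 1 != 0 :> R by rewrite mulr1 oner_neq0.
have ab2 : 1 * 2 != 0 :> R by rewrite mul1r pnatr_eq0.
have ab3 : 1 * (- 1) != 0 :> R by rewrite mulrN1 oppr_eq0 oner_neq0.
have [x1 h1 d1] := inpl _ _ ab1; have [x2 h2 d2] := inpl _ _ ab2.
have [x3 h3 d3] := inpl _ _ ab3.
have [s1 [t1 e1]] := d1 _ (sq_in_plane h1); have [s2 [t2 e2]] := d2 _ (sq_in_plane h2).
have sh : sq h = s1 *: h.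
  have [_ a1 a2] := indep3_eq ih (etrans (esym e1) e2).
  have t10 : t1 = 0 by lra.
  by rewrite e1 t10; vec; ring.
have h0 : h != 0.
  apply/eqP => h0; have [|] := ih 1 0 0; first by rewrite h0; vec; ring.
  by move/eqP; rewrite oner_eq0.
have s0 : s1 != 0.
  apply/eqP => s0; move: sh; rewrite s0 scale0r => /sq_eq0/eqP; exact/negP.
have [a1 [b1 j1]] := d1 _ (jd_in_plane h1 x1); have [a2 [b2 j2]] := d2 _ (jd_in_plane h2 x2).
have [a3 [b3 j3]] := d3 _ (jd_in_plane h3 x3).
rewrite !jE in j1 j2 j3.
have j4 : (3 * a1 - 2 * a2) *: h + (3 * b1 - 2 * b2) *: e + (3 * b1 - 4 * b2) *: f =
   a3 *: h + b3 *: e + (- b3) *: f.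
  have j12 : 3 *: (1 *: jd h e + 1 *: jd h f) - 2 *: (1 *: jd h e + 2 *: jd h f) =
     1 *: jd h e + (- 1) *: jd h f by vec; ring.
  by move: j12; rewrite j1 j2 j3 => j12; vech j12; lra.
have [_ bb1 bb2] := indep3_eq ih j4.
have b12 : b2 = b1 by lra.
have jf : jd h f = b1 *: f + (a2 - a1) *: h.
  rewrite b12 in j2.
  have j12 := congr2 (fun x y => x - y) j2 j1; vech j12; lra.
have je : jd h e = b1 *: e + (2 * a1 - a2) *: h.
  by rewrite jf in j1; vech j1; lra.
exists (s1^-1 *: h), e, f; apply: pencil_span.
- move=> a b c habc; have [|h4 h5 h6] := ih (a * s1^-1) b c.
    by vech habc; lra.
  by split=> //; apply: (mulIf (invr_neq0 s0)); rewrite mul0r.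
- by rewrite sqZ sh; vec; field.
move=> a b c; pose w := b *: e + c *: f.
have -> : a *: (s1^-1 *: h) + b *: e + c *: f = (a / s1) *: h + w.
  by rewrite /w; vec; field.
have jw : jd h w = b1 *: w + (b * (2 * a1 - a2) + c * (a2 - a1)) *: h.
  by rewrite /w !jE je jf; vec; ring.
set q := (_ + _ * _) in jw.
pose t := b + c + (a / s1) * b1.
exists (s1 * ((a / s1) ^+ 2 * s1 + (a / s1) * q - b * c - t * (a / s1))), t.
rewrite sqD sqZ jdZl jw sh [sq w]sx -/w /t.
by vec; field.
Qed.

(** For [x] with [x3 != 0], the element [w = W1 e1 + W2 e2] of the plane of [x] has [sq w] collinear
    to [w], so [W1], [W2] or [(1 - b) W1 - (1 - a) W2] is zero. One of them vanishes identically;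
    then [w] stays on the line of one idempotent, the centre of a pencil. *)
Lemma pencil_of_triangle e1 e2 e3 : indep3 e1 e2 e3 ->
  sq e1 = e1 -> sq e2 = e2 -> sq e3 = e3 ->
  span2 e1 e2 (jd e1 e2) -> span2 e1 e3 (jd e1 e3) -> span2 e2 e3 (jd e2 e3) ->
  exists h u v, pencil h u v.
Proof.
move=> i3 s1 s2 s3 [a [b j12]] [c [d j13]] [p [q j23]].
pose L1 x1 x2 x3 := x1 + a * x2 + c * x3.
pose L2 x1 x2 x3 := x2 + b * x1 + p * x3.
pose L3 x1 x2 x3 := x3 + d * x1 + q * x2.
pose W1 x1 x2 x3 := x1 * (L3 x1 x2 x3 - L1 x1 x2 x3).
pose W2 x1 x2 x3 := x2 * (L3 x1 x2 x3 - L2 x1 x2 x3).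
have sx x1 x2 x3 : sq (x1 *: e1 + x2 *: e2 + x3 *: e3) =
    L3 x1 x2 x3 *: (x1 *: e1 + x2 *: e2 + x3 *: e3) -
    (W1 x1 x2 x3 *: e1 + W2 x1 x2 x3 *: e2).
  rewrite !jE s1 s2 s3 j12 j13 j23 /W1 /W2 /L1 /L2 /L3; vec; ring.
(* [a = b = 1] would give [sq (e1 - e2) = 0]. *)
have ab1 : 1 - b != 0 \/ 1 - a != 0.
  have [b1|b1] := eqVneq (1 - b) 0; last by left.
  right; apply/eqP => a1; have : e1 - e2 = 0.
    apply: sq_eq0; rewrite !jE s1 s2 j12.
    have -> : a = 1 by lra.
    have -> : b = 1 by lra.
    by vec; ring.
  move=> e12; have [|h1 _ _] := i3 1 (- 1) 0; first by vech e12; lra.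
  by move/eqP: h1; rewrite oner_eq0.
have cyc : indep3 e2 e1 e3 by move=> x y z e; have [|-> -> ->] := i3 y x z; [vech e; lra|].
have [P1|[P2|P3]] : (forall x1 x2 x3, W1 x1 x2 x3 = 0) \/
    (forall x1 x2 x3, W2 x1 x2 x3 = 0) \/
    (forall x1 x2 x3, (1 - b) * W1 x1 x2 x3 = (1 - a) * W2 x1 x2 x3).
- have [z [f1 [f2 [f3 [f4 [[l1 l2 l3 l4] dec ev]]]]]] := indep3_basis dimA i3.
  pose g (i : R -> R -> R -> R) x := i (f1 x) (f2 x) (f3 x).
  pose D x1 x2 x3 := (1 - b) * W1 x1 x2 x3 - (1 - a) * W2 x1 x2 x3.
  have pW1 : polyfun (g W1) by rewrite /g /W1 /L3 /L1; polyfun.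
  have pW2 : polyfun (g W2) by rewrite /g /W2 /L3 /L2; polyfun.
  have pD : polyfun (g D) by rewrite /g /D; polyfun.
  have pf3 : polyfun f3 by exact: linear_form_polyfun.
  have gE i x1 x2 x3 : g i (x1 *: e1 + x2 *: e2 + x3 *: e3) = i x1 x2 x3.
    have [] := ev x1 x2 x3 0; rewrite scale0r addr0 /g => -> -> -> //.
  have f3e : f3 e3 <> 0.
    have [_ _ + _] := ev 0 0 1 0; rewrite !scale0r !add0r scale1r addr0 => ->.
    by move/eqP; rewrite oner_eq0.
  have key x : f3 x * (g W1 x * (g W2 x * g D x)) = 0.
    rewrite /g; set x1 := f1 x; set x2 := f2 x; set x3 := f3 x.
    have [->|x30] := eqVneq x3 0; first by rewrite mul0r.
    pose y := x1 *: e1 + x2 *: e2 + x3 *: e3.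
    set w1 := W1 x1 x2 x3; set w2 := W2 x1 x2 x3.
    have wE : w1 *: e1 + w2 *: e2 = L3 x1 x2 x3 *: y - sq y.
      by rewrite /y sx -/w1 -/w2; vec; ring.
    have [s [t]] : span2 y (sq y) (sq (w1 *: e1 + w2 *: e2)).
      by apply: sq_in_plane; exists (L3 x1 x2 x3), (- 1); rewrite wE scaleN1r.
    have -> : sq y = L3 x1 x2 x3 *: y - (w1 *: e1 + w2 *: e2) by rewrite wE; vec; ring.
    rewrite !jE s1 s2 j12 /y => e.
    have e' : (w1 ^+ 2 + w1 * w2 * a) *: e1 + (w2 ^+ 2 + w1 * w2 * b) *: e2 + 0 *: e3 =
      ((s + t * L3 x1 x2 x3) * x1 - t * w1) *: e1 +
      ((s + t * L3 x1 x2 x3) * x2 - t * w2) *: e2 + ((s + t * L3 x1 x2 x3) * x3) *: e3.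
      by vech e; lra.
    have [h1 h2 h3] := indep3_eq i3 e'.
    have st : s + t * L3 x1 x2 x3 = 0 by apply: (mulIf x30); rewrite mul0r -h3.
    rewrite st !mul0r !sub0r in h1 h2.
    have -> : w1 * (w2 * D x1 x2 x3) = w2 * (w1 ^+ 2 + w1 * w2 * a) - w1 * (w2 ^+ 2 + w1 * w2 * b).
      by rewrite /D -/w1 -/w2; ring.
    by rewrite h1 h2; ring.
  have [/(_ e3) //|key1] := polyfun_mul_eq0 pf3 (polyfunM pW1 (polyfunM pW2 pD)) key.
  have [h|key2] := polyfun_mul_eq0 pW1 (polyfunM pW2 pD) key1.
    by left=> x1 x2 x3; rewrite -gE h.
  right; have [h|h] := polyfun_mul_eq0 pW2 pD key2; [left|right] => x1 x2 x3.
    by rewrite -gE h.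
  by apply/eqP; rewrite -subr_eq0 -/(D x1 x2 x3) -gE h.
- exists e2, e1, e3; apply: pencil_span => // x2 x1 x3.
  exists (- W2 x1 x2 x3), (L3 x1 x2 x3).
  by rewrite [_ + x1 *: _]addrC sx P1; vec; ring.
- exists e1, e2, e3; apply: pencil_span => // x1 x2 x3.
  exists (- W1 x1 x2 x3), (L3 x1 x2 x3).
  by rewrite sx P2; vec; ring.
have E1 : (1 - b) * (d - 1) = 0 by have := P3 1 0 0; rewrite /W1 /W2 /L1 /L2 /L3; lra.
have E2 : (1 - a) * (q - 1) = 0 by have := P3 0 1 0; rewrite /W1 /W2 /L1 /L2 /L3; lra.
have E3 : (1 - b) * (1 - c) = 0 by have := P3 1 0 1; rewrite /W1 /W2 /L1 /L2 /L3; lra.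
have E4 : (1 - a) * (1 - p) = 0 by have := P3 0 1 1; rewrite /W1 /W2 /L1 /L2 /L3; lra.
have E5 : (1 - b) * (q - a) = (1 - a) * (d - b).
  by have := P3 1 1 0; rewrite /W1 /W2 /L1 /L2 /L3; lra.
have eq1 (k x : R) : k != 0 -> k * x = 0 -> x = 0.
  by move=> k0 /eqP; rewrite mulf_eq0 (negPf k0) => /eqP.
(* The cases [b = 1] and [a = 1] lead back to pencils at [e1] and [e2]. *)
have [b1|b1] := eqVneq (1 - b) 0.
  have [|a1] := ab1; first by rewrite b1 eqxx.
  have q1 := eq1 _ _ a1 E2; have p1 := eq1 _ _ a1 E4.
  have d1 : d - b = 0 by apply: (eq1 _ _ a1); rewrite -E5 b1 mul0r.
  exists e1, e2, e3; apply: pencil_span => // x1 x2 x3.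
  exists (- W1 x1 x2 x3), (L3 x1 x2 x3).
  rewrite sx; have -> : W2 x1 x2 x3 = 0; last by vec; ring.
  have -> : W2 x1 x2 x3 = x2 * ((d - b) * x1 + (q - 1) * x2 + (1 - p) * x3).
    by rewrite /W2 /L3 /L2; ring.
  by rewrite q1 p1 d1; ring.
have [a1|a1] := eqVneq (1 - a) 0.
  have d1 := eq1 _ _ b1 E1; have c1 := eq1 _ _ b1 E3.
  have q1 : q - a = 0 by apply: (eq1 _ _ b1); rewrite E5 a1 mul0r.
  exists e2, e1, e3; apply: pencil_span => // x2 x1 x3.
  exists (- W2 x1 x2 x3), (L3 x1 x2 x3).
  rewrite [_ + x1 *: _]addrC sx; have -> : W1 x1 x2 x3 = 0; last by vec; ring.
  have -> : W1 x1 x2 x3 = x1 * ((d - 1) * x1 + (q - a) * x2 + (1 - c) * x3).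
    by rewrite /W1 /L3 /L1; ring.
  by rewrite q1 c1 d1; ring.
have d1 := eq1 _ _ b1 E1; have c1 := eq1 _ _ b1 E3.
have q1 := eq1 _ _ a1 E2; have p1 := eq1 _ _ a1 E4.
(* The direction of the third idempotent in the plane of [e1] and [e2]. *)
pose g := (1 - a) *: e1 + (1 - b) *: e2.
have sg : sq g = (1 - a * b) *: g by rewrite /g !jE s1 s2 j12; vec; ring.
have D0 : 1 - a * b != 0.
  apply/eqP => D0; move: sg; rewrite D0 scale0r => /sq_eq0 g0.
  have [|h1 _ _] := i3 (1 - a) (1 - b) 0; first by rewrite /g in g0; vech g0; lra.
  by rewrite h1 eqxx in a1.
exists ((1 - a * b)^-1 *: g), e1, e3; apply: pencil_span.
- move=> x y z e; have [|h1 h2 h3] := i3 (x / (1 - a * b) * (1 - a) + y) (x / (1 - a * b) * (1 - b)) z.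
    by rewrite /g in e; vech e; lra.
  have x0 : x = 0 by apply: (mulIf (mulf_neq0 (invr_neq0 D0) b1)); rewrite mul0r mulrA.
  by split=> //; move: h1; rewrite x0 !mul0r add0r.
- by rewrite sqZ sg; vec; field.
move=> x y z; pose k := x / (1 - a * b).
have -> : x *: ((1 - a * b)^-1 *: g) + y *: e1 + z *: e3 =
   (k * (1 - a) + y) *: e1 + (k * (1 - b)) *: e2 + z *: e3.
  by rewrite /g /k; vec; ring.
set x1 := k * (1 - a) + y; set x2 := k * (1 - b).
exists (- (x1 * x2 * (1 - a * b))), (L3 x1 x2 z); rewrite sx.
have -> : W1 x1 x2 z = x1 * x2 * (1 - a).
  have -> : W1 x1 x2 z = x1 * ((d - 1) * x1 + (q - 1 + (1 - a)) * x2 + (1 - c) * z).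
    by rewrite /W1 /L3 /L1; ring.
  by rewrite q1 c1 d1; ring.
have -> : W2 x1 x2 z = x1 * x2 * (1 - b).
  have -> : W2 x1 x2 z = x2 * ((d - 1 + (1 - b)) * x1 + (q - 1) * x2 + (1 - p) * z).
    by rewrite /W2 /L3 /L2; ring.
  by rewrite q1 p1 d1; ring.
by rewrite /g; vec; field.
Qed.

(** * Existence of an omnipresent idempotent *)

(** For [x] violating omnipresence, [e], [x], [sq x] are independent; [m] is the minor of the
    coordinates of [y] and [sq y] along [x] and [sq x]. *)
Lemma omnipresent_separation e : e != 0 -> ~ omnipresent e -> sq e = e ->
  exists m : A -> R, [/\ polyfun m, exists x, m x <> 0 &
    forall y, span2 e y (sq y) -> m y = 0].
Proof.
move=> e0 /existsNP[x nx] se.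
have ex : indep2 e x.
  apply: indep2_span2 => // k xk; apply: nx; exists (k ^+ 2), 0.
  by rewrite xk sqZ se scale0r addr0.
have i3 := indep3_span2 ex nx.
have [z [f0 [f1 [f2 [f3 [[l0 l1 l2 l3] dec ev]]]]]] := indep3_basis dimA i3.
have [_ f1e f2e _] : [/\ f0 e = 1, f1 e = 0, f2 e = 0 & f3 e = 0].
  by have := ev 1 0 0 0; rewrite scale1r !scale0r !addr0.
have [_ f1x f2x _] : [/\ f0 x = 0, f1 x = 1, f2 x = 0 & f3 x = 0].
  by have := ev 0 1 0 0; rewrite scale1r !scale0r !addr0 add0r.
have [_ f1s f2s _] : [/\ f0 (sq x) = 0, f1 (sq x) = 0, f2 (sq x) = 1 & f3 (sq x) = 0].
  by have := ev 0 0 1 0; rewrite scale1r !scale0r !addr0 !add0r.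
exists (fun y => f1 y * f2 (sq y) - f2 y * f1 (sq y)); split.
- polyfun.
- by exists x; rewrite f1x f2x f2s mulr1 mul0r subr0; apply/eqP; rewrite oner_neq0.
move=> y [s [t ->]]; rewrite !l1.1 !l1.2 !l2.1 !l2.2 f1e f2e; ring.
Qed.

Lemma idempotent_multiple e f : f != 0 -> sq e = e -> sq f = f -> e <> f ->
  forall k, f <> k *: e.
Proof.
move=> f0 se sf ef k fk; have : (k ^+ 2 - k) *: e = 0.
  by rewrite scalerBl -{1}se -sqZ -fk sf subrr.
move/eqP; rewrite scaler_eq0 => /orP[|/eqP e0].
  have -> : k ^+ 2 - k = k * (k - 1) by ring.
  rewrite mulf_eq0 subr_eq0 => /orP[]/eqP k1; last by apply: ef; rewrite fk k1 scale1r.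
  by move: f0; rewrite fk k1 scale0r eqxx.
by move: f0; rewrite fk e0 scaler0 eqxx.
Qed.

(** An idempotent [a e + b f] with [a b != 0] solves [a + p b = 1], [b + q a = 1]. If this system is
    singular but solvable, then [p = q = 1] and [sq (e - f) = 0]. *)
Lemma idempotents_in_plane e f : sq e = e -> sq f = f -> indep2 e f ->
  span2 e f (jd e f) ->
  exists g, [/\ g != 0, sq g = g & forall k, k != 0 -> sq k = k -> span2 e f k ->
    [\/ k = e, k = f | k = g]].
Proof.
move=> se sf ef [p [q jef]].
have cmp a b a' b' : a *: e + b *: f = a' *: e + b' *: f -> a = a' /\ b = b'.
  move=> h; have [] := ef (a - a') (b - b'); first by vech h; lra.
  by move=> /eqP + /eqP; rewrite !subr_eq0 => /eqP-> /eqP->.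
have e0 : e != 0.
  apply/eqP => e0; have [] := ef 1 0; first by rewrite e0; vec; ring.
  by move/eqP; rewrite oner_eq0.
have coords k : k != 0 -> sq k = k -> span2 e f k ->
    [\/ k = e, k = f | exists a b, [/\ k = a *: e + b *: f, a + p * b = 1 & b + q * a = 1]].
  move=> k0 sk [a [b kab]].
  have [h1 h2] : a * (a + p * b) = a * 1 /\ b * (b + q * a) = b * 1.
    by apply: cmp; rewrite !mulr1 -kab -sk kab !jE se sf jef; vec; ring.
  have [a0|a0] := eqVneq a 0.
    constructor 2; have [b0|b0] := eqVneq b 0.
      by move: k0; rewrite kab a0 b0 !scale0r addr0 eqxx.
    by rewrite kab a0; have := mulfI b0 h2; rewrite a0 mulr0 addr0 => ->; vec; ring.
  have [b0|b0] := eqVneq b 0.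
    by constructor 1; rewrite kab b0; have := mulfI a0 h1; rewrite b0 mulr0 addr0 => ->; vec; ring.
  by constructor 3; exists a, b; split=> //; [exact: mulfI h1|exact: mulfI h2].
have [[g [g0 sg [a [b [gab h1 h2]]]]]|nog] := pselect (exists g, [/\ g != 0, sq g = g &
   exists a b, [/\ g = a *: e + b *: f, a + p * b = 1 & b + q * a = 1]]); last first.
  (* If there is no third idempotent, [e] is repeated as [g]. *)
  exists e; split=> // k k0 sk /(coords _ k0 sk) [|| [a [b h]]]; [by constructor 1|by constructor 2|].
  by case: nog; exists k; split=> //; exists a, b.
exists g; split=> // k k0 sk /(coords _ k0 sk) [|| [a' [b' [kab h3 h4]]]];
  [by constructor 1|by constructor 2|constructor 3].
have pq : 1 - p * q != 0.
  apply/eqP => pq; have p1 : p = 1.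
    have : a * (1 - p * q) = (a + p * b) - p * (b + q * a) by ring.
    by rewrite h1 h2 pq; lra.
  have q1 : q = 1 by rewrite p1 in pq; lra.
  have ef0 : e - f = 0 by apply: sq_eq0; rewrite !jE se sf jef p1 q1; vec; ring.
  by have [|] := ef 1 (- 1); [vech ef0; lra|move/eqP; rewrite oner_eq0].
rewrite kab gab; congr (_ *: _ + _ *: _); apply: (mulIf pq).
  have -> : a' * (1 - p * q) = (a' + p * b') - p * (b' + q * a') by ring.
  have -> : a * (1 - p * q) = (a + p * b) - p * (b + q * a) by ring.
  by rewrite h1 h2 h3 h4.
have -> : b' * (1 - p * q) = (b' + q * a') - q * (a' + p * b') by ring.
have -> : b * (1 - p * q) = (b + q * a) - q * (a + p * b) by ring.
by rewrite h1 h2 h3 h4.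
Qed.

Lemma exists_omnipresent : exists e, [/\ e != 0, sq e = e & omnipresent e].
Proof.
have [[h [u [v hp]]]|nop] := pselect (exists h u v, pencil h u v).
  exact: pencil_omnipresent hp.
have adj e f : sq e = e -> sq f = f -> indep2 e f -> span2 e f (jd e f).
  by move=> se sf ef; apply: contrapT => /(pencil_of_nonadjacent se sf ef).
have [|x xU] := @vspace_escape R A 0%VS; first by rewrite dimv0 dimA.
have x0 : x != 0 by rewrite memv0 in xU.
have [e [e0 se _]] := idempotent_in_plane x0.
have [oe|noe] := pselect (omnipresent e); first by exists e.
have [me [pme [xe mxe] me0]] := omnipresent_separation e0 noe se.
have nz (m : A) y : (forall y, span2 m y (sq y) -> me y = 0) -> me y <> 0 -> y != 0.
  move=> hm my; apply/eqP => y0; apply: my; apply: hm.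
  by exists 0, 0; rewrite y0 !scale0r addr0 /sq (linear0l mul).
(* [me xe != 0] keeps [e] out of the plane of [xe], so [f] differs from [e]. *)
have [f [f0 sf sfx]] := idempotent_in_plane (nz _ _ me0 mxe).
have ef : e <> f by move=> ef; apply: mxe; apply: me0; rewrite ef.
have ief : indep2 e f by apply: indep2_span2 => //; exact: idempotent_multiple.
have [of_|nof] := pselect (omnipresent f); first by exists f.
have [mf [pmf [xf mxf] mf0]] := omnipresent_separation f0 nof sf.
have [g [g0 sg hg]] := idempotents_in_plane se sf ief (adj _ _ se sf ief).
have [og|nog] := pselect (omnipresent g); first by exists g.
have [mg [pmg [xg mxg] mg0]] := omnipresent_separation g0 nog sg.
(* Each plane with [me y != 0] contains one of [e], [f], [g], so the product vanishes; by the
   identity principle some factor is identically zero, a contradiction. *)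
have prod y : me y * (mf y * mg y) = 0.
  have [->|mey] := eqVneq (me y) 0; first by rewrite mul0r.
  have y0 : y != 0 by apply: (nz _ _ me0); exact/eqP.
  have [k [k0 sk ky]] := idempotent_in_plane y0.
  have kef : span2 e f k.
    (* Outside the plane of [e] and [f], [k] would complete a triangle. *)
    apply: contrapT => nk; apply: nop.
    have i3 := indep3_span2 ief nk.
    have ik j : j != 0 -> sq j = j -> j <> k -> span2 j k (jd j k).
      move=> j0 sj jk; apply: adj => //; apply: indep2_span2 => //.
      exact: idempotent_multiple.
    apply: (pencil_of_triangle i3) => //; first exact: adj.
      by apply: ik => // ek; apply: nk; rewrite -ek; exists 1, 0; vec; ring.
    by apply: ik => // fk; apply: nk; rewrite -fk; exists 0, 1; vec; ring.
  have [ke|kf|kg] := hg k k0 sk kef.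
  - by rewrite me0 ?mul0r // -ke.
  - by rewrite mf0 ?mul0r ?mulr0 // -kf.
  - by rewrite mg0 ?mulr0 // -kg.
have [/(_ xe)//|prod2] := polyfun_mul_eq0 pme (polyfunM pmf pmg) prod.
by have [/(_ xf)|/(_ xg)] := polyfun_mul_eq0 pmf pmg prod2.
Qed.

End PowerCommutative.

(** * Two-dimensional subalgebras *)

Theorem theorem1 (R : realType) (A : vectType R) (mul : {bilinear A -> A -> A}) :
  \dim {:A} = 4%N ->
  division_algebra mul ->
  power_commutative mul ->
  exists e : A, omnipresent_idempotent mul e.
Proof.
move=> dimA divA pcA; have [e [e0 se oe]] := exists_omnipresent dimA divA pcA.
exists e; split=> // U subU dimU.
have /subvPn[a aU] : ~~ (U <= 0)%VS.
  by apply/negP => /dimvS; rewrite dimU dimv0.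
rewrite memv0 => a0.
have /subvPn[b bU ba] : ~~ (U <= <[a]>)%VS.
  by apply/negP => /dimvS; rewrite dimU dim_vline a0.
have ab : indep2 a b.
  by apply: indep2_span2 => // k bk; move: ba; rewrite bk memvZ // memv_line.
(* For [x] in [U] with [sq x] not a multiple of [x], [sq x = p e + q x] has [p != 0], which puts [e]
   in [U]. *)
have [s [t nx]] := indep2_not_collinear_sq divA ab.
set x := s *: a + t *: b in nx; have xU : x \in U by rewrite memvD // memvZ.
have [p [q hx]] := oe x.
have p0 : p != 0.
  by apply/eqP => p0; apply: nx; exists q; rewrite hx p0 scale0r add0r.
have -> : e = p^-1 *: (mul x x - q *: x).
  by rewrite -[mul x x]/(sq mul x) hx addrK scalerA mulVf // scale1r.
by rewrite memvZ // memvB ?subU // memvZ.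
Qed.
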